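(* Let $\{(\phi^n,u^n)\}_{n=0}^{N}$ and $\{\eta^{n-\frac12}\}_{n=1}^{N}$ satisfy the CN-IEQ time-stepping scheme: for $1\leq n\leq N$, $$(\partial_{\tau}^{\alpha}\phi)^{n-\frac12}=-\lambda\left(-\varepsilon^{2}\Delta\phi^{n-\frac12}+\beta\phi^{n-\frac12}+u^{n-\frac12}\hat{\phi}^{n-\frac12}-\eta^{n-\frac12}\right),$$ $$\eta^{n-\frac12}=\frac{1}{|\Omega|}\int_{\Omega}\left(-\varepsilon^{2}\Delta\phi^{n-\frac12}+\beta\phi^{n-\frac12}+u^{n-\frac12}\hat{\phi}^{n-\frac12}\right)\mathrm{d}\mathbf{x},$$ $$\partial_{\tau}u^{n-\frac12}=2\hat{\phi}^{n-\frac12}\,\partial_{\tau}\phi^{n-\frac12}.$$ Define the discrete energy $$E[\phi^{n},u^{n}]=\int_{\Omega}\left(\frac{\varepsilon^{2}}{2}|\nabla\phi^{n}|^{2}+\frac{\beta}{2}|\phi^{n}|^{2}+\frac14(u^{n})^{2}\right)\mathrm{d}\mathbf{x}-\left(\frac{\beta}{2}+\frac{\beta^{2}}{4}\right)|\Omega|.$$ Then, with no restriction on the time steps (unconditional energy stability), the scheme preserves the energy dissipation law $$E[\phi^{n},u^{n}]-E[\phi^{0},u^{0}]\leq0\quad\text{for } 1\leq n\leq N.$$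
   Context: Parameters: $0<\alpha<1$, $\lambda>0$ (mobility), $\varepsilon>0$ (interface width), $\beta$ a real regularization parameter. $\Omega\subset\mathbb{R}^d$ is a bounded rectangular domain with periodic boundary conditions, and $|\Omega|$ is its measure. The scheme is discrete in time only; the functions $\phi^n,u^n:\Omega\to\mathbb{R}$ are $\Omega$-periodic and sufficiently smooth in space for all expressions (and integration by parts) to make sense, and $\eta^{n-\frac12}\in\mathbb{R}$ is constant in space. Time mesh: arbitrary nonuniform levels $0=t_0<t_1<\cdots<t_N=T$, steps $\tau_k:=t_k-t_{k-1}$, local step ratios $\rho_k:=\tau_k/\tau_{k+1}$. For a sequence $\{v^k\}$: $\triangledown_\tau v^k:=v^k-v^{k-1}$, $\partial_\tau v^{k-\frac12}:=\triangledown_\tau v^k/\tau_k$, $v^{k-\frac12}:=(v^k+v^{k-1})/2$ for $k\geq1$. L1$^+$ formula (approximating the Caputo derivative of order $\alpha$): $$(\partial_\tau^\alpha v)^{n-\frac12}:=\sum_{k=1}^n a_{n-k}^{(n)}\triangledown_\tau v^k,\qquad a_{n-k}^{(n)}:=\frac{1}{\tau_n\tau_k}\int_{t_{n-1}}^{t_n}\int_{t_{k-1}}^{\min\{t,t_k\}}\omega_{1-\alpha}(t-s)\,\mathrm{d}s\,\mathrm{d}t\quad(1\leq k\leq n),$$ where $\omega_{\mu}(t):=t^{\mu-1}/\Gamma(\mu)$. Extrapolation: $\hat\phi^{n-\frac12}:=\phi^{n-1}+\triangledown_\tau\phi^{n-1}/(2\rho_{n-1})$ for $n\geq2$; for $n=1$,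 $\hat\phi^{\frac12}$ is a prescribed smooth $\Omega$-periodic function (for instance $\phi^0$). Initial data: $\phi^0=\phi_0$ is given and $u^0=\phi_0^2-1-\beta$. *)

(* Defs.v *)
From HB Require Import structures.
From mathcomp Require Import all_boot all_order all_algebra.
From mathcomp Require Import all_classical all_reals all_analysis.

Set Implicit Arguments.
Unset Strict Implicit.
Unset Printing Implicit Defensive.

Import Order.TTheory GRing.Theory Num.Theory.
Import numFieldNormedType.Exports.

Local Open Scope classical_set_scope.
Local Open Scope ring_scope.

(* Lebesgue measure on R^d, carried by [d.-tuple R] because this is the power
   that the library equips with the product sigma-algebra. *)
Section lebesgue_tuple.
Context (R : realType).

Definition tuple_cons (d : nat) (x : R * d.-tuple R) : d.+1.-tuple R :=
  [tuple of x.1 :: x.2].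

Definition tuple_uncons (d : nat) (x : d.+1.-tuple R) : R * d.-tuple R :=
  (thead x, [tuple of behead x]).

Lemma tuple_consK d : cancel (@tuple_cons d) (@tuple_uncons d).
Proof. by case=> x t; congr pair; apply/val_inj. Qed.

Lemma tuple_unconsK d : cancel (@tuple_uncons d) (@tuple_cons d).
Proof. by move=> t; rewrite [RHS]tuple_eta. Qed.

Lemma measurable_tuple_cons d : measurable_fun setT (@tuple_cons d).
Proof. by apply: measurable_cons => //; exact: measurable_snd. Qed.

Lemma measurable_tuple_uncons d : measurable_fun setT (@tuple_uncons d).
Proof.
apply: measurable_fun_pair; last exact: measurable_behead.
exact: measurable_tnth.
Qed.

Section step.
Variables (d : nat) (m : {sigma_finite_measure set (d.-tuple R) -> \bar R}).

Definition lebesgue_tupleS : set (d.+1.-tuple R) -> \bar R :=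
  pushforward (lebesgue_measure \x m)%E (@tuple_cons d).

HB.instance Definition _ := Measure.copy lebesgue_tupleS
  (measure_function_pushforward__canonical__measure_function_Measure
     (lebesgue_measure \x m)%E (@measurable_tuple_cons d)).

Lemma sigma_finite_lebesgue_tupleS : sigma_finite setT lebesgue_tupleS.
Proof.
have /sigma_finiteP[F [FT ndF Ffin]] := sigma_finiteT (@lebesgue_measure R).
have /sigma_finiteP[G [GT ndG Gfin]] := sigma_finiteT m.
have mFG k : measurable (F k `*` G k).
  by apply: measurableX; [have [] := Ffin k|have [] := Gfin k].
exists (fun k => @tuple_uncons d @^-1` (F k `*` G k)).
  rewrite -preimage_bigcup -[LHS](preimage_setT (@tuple_uncons d)).
  congr (_ @^-1` _); rewrite -setXTT FT GT predeqE => -[x y]; split.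
    move=> [/= [i _ Fx] [j _ Gy]]; exists (maxn i j) => //; split.
    - by move: x Fx; exact/subsetPset/ndF/leq_maxl.
    - by move: y Gy; exact/subsetPset/ndG/leq_maxr.
  by move=> [i _ []/= ? ?]; split; exists i.
move=> k; split.
  rewrite -[X in measurable X]setTI.
  exact: measurable_tuple_uncons measurableT _ (mFG k).
rewrite /lebesgue_tupleS /pushforward -comp_preimage.
rewrite (_ : _ \o _ = id); last by apply/funext => x /=; rewrite tuple_consK.
have [? ?] := Ffin k; have [? ?] := Gfin k.
by rewrite preimage_id product_measure1E// lte_mul_pinfty// ge0_fin_numE.
Qed.

HB.instance Definition _ := @Measure_isSigmaFinite.Build _ _ _
  lebesgue_tupleS sigma_finite_lebesgue_tupleS.

End step.

Definition lebesgue_tuple0 : set (0.-tuple R) -> \bar R :=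
  @dirac _ _ [tuple] R.
HB.instance Definition _ := Measure.on lebesgue_tuple0.

Lemma sigma_finite_lebesgue_tuple0 : sigma_finite setT lebesgue_tuple0.
Proof.
exists (fun=> setT); first by rewrite bigcup_const.
by move=> _; split => //; rewrite /lebesgue_tuple0 diracE ltry.
Qed.

HB.instance Definition _ := @Measure_isSigmaFinite.Build _ _ _
  lebesgue_tuple0 sigma_finite_lebesgue_tuple0.

Fixpoint lebesgue_tuple (d : nat) :
    {sigma_finite_measure set (d.-tuple R) -> \bar R} :=
  match d with
  | 0%N => lebesgue_tuple0
  | d'.+1 => lebesgue_tupleS (lebesgue_tuple d')
  end.

End lebesgue_tuple.

Section periodic_box.
Context (R : realType) (d : nat).
Implicit Types (D : set 'rV[R]_d) (f : 'rV[R]_d -> R) (a b : 'rV[R]_d).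

Definition tuple_row (t : d.-tuple R) : 'rV[R]_d := \row_i tnth t i.

Definition integral_rV D f : R :=
  \int[lebesgue_tuple R d]_(t in tuple_row @^-1` D) f (tuple_row t).

Definition volume D : R := fine (lebesgue_tuple R d (tuple_row @^-1` D)).

Definition box a b : set 'rV[R]_d :=
  [set x | forall i, a ord0 i < x ord0 i < b ord0 i].

Definition unit_row (i : 'I_d) : 'rV[R]_d := delta_mx ord0 i.

(* Periodic functions on [box a b] are represented by their periodic extension
   to the whole of R^d. *)
Definition box_periodic a b f :=
  forall i x, f (x + (b ord0 i - a ord0 i) *: unit_row i) = f x.

Definition partial (i : 'I_d) f : 'rV[R]_d -> R := 'D_(unit_row i) f.

Fixpoint class_C (k : nat) f : Prop :=
  match k with
  | 0%N => continuous f
  | k'.+1 => continuous f /\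
      forall i, (forall x, derivable f x (unit_row i)) /\
                class_C k' (partial i f)
  end.

Definition gradient f (x : 'rV[R]_d) : 'rV[R]_d := \row_i partial i f x.

Definition laplacian f (x : 'rV[R]_d) : R :=
  \sum_(i < d) partial i (partial i f) x.

(* The library norm [`|v|] on row vectors is the sup norm, hence this one. *)
Definition sqnorm2 (v : 'rV[R]_d) : R := \sum_(i < d) v ord0 i ^+ 2.

End periodic_box.

Section time_mesh.
Context (R : realType).
Implicit Types (t : nat -> R) (n k : nat).

Definition tau t k : R := t k - t k.-1.

Definition rho t k : R := tau t k / tau t k.+1.

Definition Gamma (x : R) : R :=
  \int[lebesgue_measure]_(s in `]0, +oo[) (s `^ (x - 1) * expR (- s)).

Definition omega (mu s : R) : R := s `^ (mu - 1) / Gamma mu.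

(* [L1plus_coef alpha t n k] is a_{n-k}^{(n)}: the second index is k, not n-k. *)
Definition L1plus_coef (alpha : R) t n k : R :=
  (tau t n * tau t k)^-1 *
  \int[lebesgue_measure]_(r in `[t n.-1, t n])
    \int[lebesgue_measure]_(s in `[t k.-1, Num.min r (t k)])
      omega (1 - alpha) (r - s).

(* Operators on sequences of functions; the value at [n] of [mid], [dquot],
   [L1plus] and [extrapolation] is the one the time level n - 1/2 carries. *)
Context (X : Type).
Implicit Types (v : nat -> X -> R) (x : X).

Definition bdiff v n x : R := v n x - v n.-1 x.

Definition mid v n x : R := (v n x + v n.-1 x) / 2.

Definition dquot t v n x : R := bdiff v n x / tau t n.

Definition L1plus (alpha : R) t v n x : R :=
  \sum_(1 <= k < n.+1) L1plus_coef alpha t n k * bdiff v k x.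

Definition extrapolation t (w1 : X -> R) v n x : R :=
  if n == 1%N then w1 x
  else v n.-1 x + bdiff v n.-1 x / (2 * rho t n.-1).

End time_mesh.

Section CN_IEQ.
Context (R : realType) (d : nat).
Implicit Types (phi u : nat -> 'rV[R]_d -> R) (f w : 'rV[R]_d -> R).

(* Right-hand side of the scheme at level n - 1/2 without the multiplier eta;
   [w1] is the prescribed extrapolation at level 1/2. *)
Definition potential (eps beta : R) (t : nat -> R) w1 phi u n x : R :=
  - eps ^+ 2 * laplacian (mid phi n) x + beta * mid phi n x
  + mid u n x * extrapolation t w1 phi n x.

Definition CN_IEQ_step (alpha lambda eps beta : R) (a b : 'rV[R]_d)
    (t : nat -> R) w1 phi u (eta : nat -> R) (n : nat) : Prop :=
  [/\ forall x, box a b x ->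
        L1plus alpha t phi n x =
        - lambda * (potential eps beta t w1 phi u n x - eta n),
      eta n = (volume (box a b))^-1 *
        integral_rV (box a b) (potential eps beta t w1 phi u n)
    & forall x, box a b x ->
        dquot t u n x = 2 * extrapolation t w1 phi n x * dquot t phi n x].

Definition energy (eps beta : R) (a b : 'rV[R]_d) f w : R :=
  integral_rV (box a b) (fun x =>
    eps ^+ 2 / 2 * sqnorm2 (gradient f x) + beta / 2 * `|f x| ^+ 2
    + 4^-1 * w x ^+ 2)
  - (beta / 2 + beta ^+ 2 / 4) * volume (box a b).

End CN_IEQ.

(* Main.v *)
Require Import Defs.
From HB Require Import structures.
From mathcomp Require Import all_boot all_order all_algebra.
From mathcomp Require Import all_classical all_reals all_analysis.
From mathcomp Require Import measurable_realfun ring lra.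

Import Order.TTheory GRing.Theory Num.Theory.
Import numFieldNormedType.Exports.

Local Open Scope classical_set_scope.
Local Open Scope ring_scope.

Set Implicit Arguments.
Unset Strict Implicit.
Unset Printing Implicit Defensive.

(** The energy increment of one step is an exact quantity, and summing over the
    steps leaves a quadratic form in time which is nonnegative on every mesh.

    Multiply the first equation at level n - 1/2 by the increment
    [bdiff phi n] and integrate over the periodic box.  The Laplacian
    contributes the increment of the gradient energy, since the difference is
    the integral of a divergence of a periodic field
    ([integral_green_density]); the linear term contributes the increment of
    [beta / 2 * phi ^ 2]; and, by the third equation, the term with [u] is
    the increment of [u ^ 2 / 4].  The multiplier [eta] disappears because mass
    is conserved ([mass_conservation]): integrating the first equation shows
    that the L1+ formula applied to the masses vanishes, and this is a
    triangular system with positive diagonal coefficients.  Hence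
    [energy_step]: the energy increment is [- 1 / lambda] times the integral of
    the L1+ derivative against [bdiff phi n].

    Summing over n, everything rests on the pointwise statement [L1plus_psd]:
    the lower triangular matrix of L1+ coefficients defines a nonnegative
    quadratic form.  Integrating the kernel [(r - s) ^ (- alpha)] twice
    expresses the coefficients by mixed second differences of the power
    [|x| ^ (2 - alpha)] at the mesh points ([pow_incr]), the diagonal
    coefficients being half of the symmetric ones.  For [1 < g < 2] the power
    [|x| ^ g] is, up to a positive factor, the integral over [y > 0] of
    [(1 - cos (y x)) * y ^ (- 1 - g)] ([Rintegral_cos_density]).  Under the
    mixed difference the constant 1 drops out, and [- cos (y (r - s))] splits
    into products of increments of [cos (y t)] and [sin (y t)] over the two
    mesh cells; the double sum is therefore an integral of a sum of two
    squares. *)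

(** * Improper integrals on the line *)

(** Only the primitive [F] has to be continuous up to the endpoints, so that the
    singular kernel [(r - s) ^ (- alpha)] is covered: the fundamental theorem on
    compact subintervals passes to the limit by monotone convergence. *)
Lemma ge0_improper_FTC (R : realType) (f F : R -> R) (a b : R) : a < b ->
  (forall x, a < x < b -> 0 <= f x) ->
  (forall x, a < x < b -> {for x, continuous f}) ->
  (forall x, a < x < b -> is_derive x 1 F (f x)) ->
  F @ a^'+ --> F a -> F @ b^'- --> F b ->
  (\int[lebesgue_measure]_(x in `]a, b[) (f x)%:E = (F b - F a)%:E)%E.
Proof.
move=> ab f0 cf dF Fa Fb.
(* With denominators from 3 on, [a + e n < b - e n] for every n. *)
pose e (n : nat) : R := (b - a) / n.+3%:R.
have ba0 : 0 < b - a by rewrite subr_gt0.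
have e0 n : 0 < e n by rewrite divr_gt0.
have e2 n : e n * 2 < b - a.
  by rewrite /e mulrAC ltr_pdivrMr// ltr_pM2l// ltr_nat !ltnS.
have e_cvg0 : e n @[n --> \oo] --> 0.
  rewrite -(mulr0 (b - a)); apply: cvgMl_tmp.
  have := @cvg_harmonic R; rewrite -(cvg_shiftn 2)/=.
  by under eq_fun do rewrite /harmonic/= addn2.
have abe n : a + e n < b - e n by have := e2 n; lra.
pose I (n : nat) : set R := `[a + e n, b - e n]%classic.
have Iab n x : I n x -> a < x < b.
  rewrite /I/= in_itv/= => /andP[h1 h2]; have en := e0 n.
  by apply/andP; split; lra.
have II n : (\int[lebesgue_measure]_(x in I n) (f x)%:E =
             (F (b - e n) - F (a + e n))%:E)%E.
  rewrite EFinB; apply: continuous_FTC2 => //.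
  - apply: continuous_in_subspaceT => x /[!inE] Ix.
    exact/cf/(Iab n).
  - have cF x : a < x < b -> {for x, continuous F}.
      move=> xab; apply/differentiable_continuous/derivable1_diffP.
      by case: (dF _ xab).
    split.
    + move=> x; rewrite in_itv/= => /andP[h1 h2].
      have en := e0 n; suff xab : a < x < b by case: (dF _ xab).
      by apply/andP; split; lra.
    + apply: cvg_at_right_filter; apply: cF.
      have en := e0 n; have aben := abe n; apply/andP; split; lra.
    + apply: cvg_at_left_filter; apply: cF.
      have en := e0 n; have aben := abe n; apply/andP; split; lra.
  - move=> x; rewrite in_itv/= => /andP[h1 h2].
    rewrite derive1E; have en := e0 n; have xab : a < x < b.
      by have en' := e0 n; apply/andP; split; lra.
    by case: (dF _ xab).
have UI : \bigcup_n I n = `]a, b[%classic.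
  apply/seteqP; split=> [x [n _ /Iab]|x]; first by rewrite /= in_itv.
  rewrite /= in_itv/= => /andP[ax xb].
  have m0 : 0 < Num.min (x - a) (b - x) by rewrite lt_min !subr_gt0 ax.
  have [n _ /(_ n (leqnn n))] := (cvgrPdist_lt _ _).1 e_cvg0 _ m0.
  rewrite sub0r normrN gtr0_norm// lt_min => /andP[h1 h2].
  by exists n => //; rewrite /I/= in_itv/=; apply/andP; split; lra.
have I_nd : nondecreasing_seq I.
  move=> m n mn; apply/subsetPset => x; rewrite /I/= !in_itv/= => /andP[h1 h2].
  have : e n <= e m by rewrite /e ler_pM2l// lef_pV2 ?posrE// ler_nat !ltnS.
  by move=> h; apply/andP; split; lra.
have mf : measurable_fun `]a, b[ (EFin \o f).
  apply/measurable_EFinP; apply: open_continuous_measurable_fun.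
    exact: interval_open.
  move=> x.
  by rewrite inE/= in_itv/=; exact: cf.
have c1 : (\int[lebesgue_measure]_(x in I n) (f x)%:E @[n --> \oo] -->
    \int[lebesgue_measure]_(x in `]a, b[) (f x)%:E)%E.
  rewrite -UI; apply: ge0_nondecreasing_set_cvg_integral => //.
  - by move=> n; exact: measurable_itv.
  - move=> n; apply: (@measurable_funS _ _ _ _ `]a, b[%classic) => //.
    by move=> x /Iab; rewrite /= in_itv.
  - by move=> n x /Iab; rewrite lee_fin; exact: f0.
have c2 : (\int[lebesgue_measure]_(x in I n) (f x)%:E @[n --> \oo] -->
    (F b - F a)%:E)%E.
  under eq_cvg do rewrite II.
  apply: cvg_EFin; first exact: nearW.
  apply: (@cvgB _ _ _ _ _ (fun n => F (b - e n)) (fun n => F (a + e n))).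
  - move/cvg_at_leftP : Fb; apply; split.
      by move=> n; rewrite ltrBlDr ltrDl.
    by rewrite -[X in _ --> X]subr0; apply: cvgB => //; exact: cvg_cst.
  - move/cvg_at_rightP : Fa; apply; split.
      by move=> n; rewrite ltrDl.
    by rewrite -[X in _ --> X]addr0; apply: cvgD => //; exact: cvg_cst.
exact: cvg_unique c1 c2.
Qed.

Lemma is_derive_powR (R : realType) (p x : R) : 0 < x ->
  is_derive x 1 (@powR R ^~ p) (p * x `^ (p - 1)).
Proof.
move=> x0; have xI : x \in `]0, +oo[ by rewrite in_itv/= x0.
split; first exact: derivable_powR.
by rewrite -derive1E powR_derive1.
Qed.

Lemma continuous_norm_powR (R : realType) (p : R) : 0 < p ->
  continuous (fun x : R => `|x| `^ p).
Proof.
move=> p0 x; have [->|x0] := eqVneq x 0.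
  apply/cvgrPdist_lt => e e0; near=> y.
  rewrite normr0 powR0 ?gt_eqF// sub0r normrN ger0_norm ?powR_ge0//.
  have -> : e = (e `^ p^-1) `^ p.
    by rewrite -powRrM mulVf ?gt_eqF// powRr1// ltW.
  apply: gt0_ltr_powR; rewrite ?nnegrE ?powR_ge0//.
  near: y; exact: (@nbhs0_lt R R _ (powR_gt0 _ e0)).
apply: (@continuous_comp R R R (fun y => `|y|) (@powR R ^~ p)).
  exact: (@norm_continuous R R).
apply/differentiable_continuous/derivable1_diffP.
by case: (@is_derive_powR R p `|x|); rewrite ?normr_gt0.
Unshelve. all: by end_near. Qed.

Lemma ge0_improper_FTC_itvcc (R : realType) (f F : R -> R) (a b : R) :
  a <= b -> measurable_fun setT f ->
  (forall x, a < x < b -> 0 <= f x) ->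
  (forall x, a < x < b -> {for x, continuous f}) ->
  (forall x, a < x < b -> is_derive x 1 F (f x)) -> continuous F ->
  (\int[lebesgue_measure]_(x in `[a, b]) (f x)%:E = (F b - F a)%:E)%E.
Proof.
rewrite le_eqVlt => /predU1P[<- *|ab mf f0 cf dF cF].
  by rewrite set_itv1 integral_set1 subrr.
rewrite -integral_itv_bndo_bndc; last exact/measurable_EFinP/measurable_funTS.
rewrite -integral_itv_obnd_cbnd; last exact/measurable_EFinP/measurable_funTS.
apply: ge0_improper_FTC => //.
- exact/cvg_at_right_filter/cF.
- exact/cvg_at_left_filter/cF.
Qed.

Lemma integral_powR_subr (R : realType) (p r c e : R) : 0 < p -> c <= e <= r ->
  (\int[lebesgue_measure]_(s in `[c, e]) ((r - s) `^ (p - 1))%:E =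
  (((r - c) `^ p - (r - e) `^ p) / p)%:E)%E.
Proof.
move=> p0 /andP[ce er].
pose F (s : R) := - p^-1 * `|r - s| `^ p.
have -> : ((r - c) `^ p - (r - e) `^ p) / p = F e - F c.
  rewrite /F !ger0_norm ?subr_ge0 ?(le_trans ce)//.
  by rewrite mulrBl !mulNr opprK addrC !(mulrC p^-1).
apply: ge0_improper_FTC_itvcc => //.
- have mg : measurable_fun setT (fun s : R => r - s) by apply: measurable_funB.
  exact: (measurableT_comp (@measurable_powR R (p - 1)) mg).
- by move=> x _; exact: powR_ge0.
- move=> s /andP[cs se].
  apply: (@continuous_comp R R R (fun s => r - s) (@powR R ^~ (p - 1))).
    by apply: continuousB; [exact: cvg_cst|exact: cvg_id].
  apply/differentiable_continuous/derivable1_diffP.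
  have rs : 0 < r - s by rewrite subr_gt0 (lt_le_trans se).
  by case: (is_derive_powR (p - 1) rs).
- move=> s /andP[cs se].
  have rs : 0 < r - s by rewrite subr_gt0 (lt_le_trans se).
  apply: (@near_eq_is_derive _ _ _ (fun s => - p^-1 * (r - s) `^ p)).
    near=> y; rewrite /F ger0_norm// subr_ge0 ltW//; near: y.
    by apply: lt_nbhsl; rewrite -subr_gt0.
  have dr : is_derive s 1 (fun s : R => r - s) (-1).
    rewrite -[X in is_derive _ _ _ X]sub0r; exact: is_deriveB.
  have := @is_derive1_comp _ (@powR R ^~ p) (fun s => r - s) _ _ _
    (is_derive_powR p rs) dr.
  move=> /(is_deriveZ (- p^-1)) dF; apply: (is_derive_eq dF).
  rewrite /GRing.scale/= mulrN1 mulrN mulNr opprK mulrA mulVf ?mul1r//.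
  by rewrite gt_eqF.
- move=> s; apply: cvgMl_tmp.
  apply: (@continuous_comp R R R (fun s => r - s) (fun x => `|x| `^ p)).
    by apply: continuousB; [exact: cvg_cst|exact: cvg_id].
  exact: continuous_norm_powR.
Unshelve. all: by end_near. Qed.

Lemma integral_powR_addr (R : realType) (p a c e : R) : 0 < p -> a <= c <= e ->
  (\int[lebesgue_measure]_(s in `[c, e]) ((s - a) `^ (p - 1))%:E =
  (((e - a) `^ p - (c - a) `^ p) / p)%:E)%E.
Proof.
move=> p0 /andP[ac ce].
pose F (s : R) := p^-1 * `|s - a| `^ p.
have -> : ((e - a) `^ p - (c - a) `^ p) / p = F e - F c.
  rewrite /F !ger0_norm ?subr_ge0 ?(le_trans ac)//.
  by rewrite mulrBl !(mulrC p^-1).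
apply: ge0_improper_FTC_itvcc => //.
- have mg : measurable_fun setT (fun s : R => s - a) by apply: measurable_funB.
  exact: (measurableT_comp (@measurable_powR R (p - 1)) mg).
- by move=> x _; exact: powR_ge0.
- move=> s /andP[cs se].
  apply: (@continuous_comp R R R (fun s => s - a) (@powR R ^~ (p - 1))).
    by apply: continuousB; [exact: cvg_id|exact: cvg_cst].
  apply/differentiable_continuous/derivable1_diffP.
  have rs : 0 < s - a by rewrite subr_gt0 (le_lt_trans ac).
  by case: (is_derive_powR (p - 1) rs).
- move=> s /andP[cs se].
  have rs : 0 < s - a by rewrite subr_gt0 (le_lt_trans ac).
  apply: (@near_eq_is_derive _ _ _ (fun s => p^-1 * (s - a) `^ p)).
    near=> y; rewrite /F ger0_norm// subr_ge0 ltW//; near: y.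
    by apply: lt_nbhsr; rewrite -subr_gt0.
  have dr : is_derive s 1 (fun s : R => s - a) 1.
    rewrite -[X in is_derive _ _ _ X]subr0; exact: is_deriveB.
  have := @is_derive1_comp _ (@powR R ^~ p) (fun s => s - a) _ _ _
    (is_derive_powR p rs) dr.
  move=> /(is_deriveZ p^-1) dF; apply: (is_derive_eq dF).
  by rewrite /GRing.scale/= mulr1 mulrA mulVf ?mul1r// gt_eqF.
- move=> s; apply: cvgMl_tmp.
  apply: (@continuous_comp R R R (fun s => s - a) (fun x => `|x| `^ p)).
    by apply: continuousB; [exact: cvg_id|exact: cvg_cst].
  exact: continuous_norm_powR.
Unshelve. all: by end_near. Qed.

Lemma integral_powRN2_itv1y (R : realType) :
  (\int[lebesgue_measure]_(x in `[1%R, +oo[) (x `^ (- 2))%:E = (1 : R)%:E)%E.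
Proof.
under eq_integral => x.
  rewrite inE/= in_itv/= andbT => x1; rewrite (powR_invn 2) ?(le_trans ler01)//.
  over.
have dV (x : R) : 0 < x -> is_derive x 1 (fun y : R => - y^-1) (x ^- 2).
  move=> x0; have := @is_deriveV R id x 1 1 (lt0r_neq0 x0) (is_derive_id _ _).
  move=> /is_deriveN dF; apply: (is_derive_eq dF).
  by rewrite scaleNr opprK /GRing.scale/= mulr1.
have cV (x : R) : 0 < x -> {for x, continuous (fun y : R => - y^-1)}.
  move=> /dV[dF _]; exact/differentiable_continuous/derivable1_diffP.
rewrite (@ge0_continuous_FTC2y _ _ (fun y => - y^-1) 1 0).
- by rewrite invr1 EFinN oppeK add0e.
- by move=> x x1; rewrite invr_ge0 sqr_ge0.
- apply: continuous_in_subspaceT => x; rewrite inE/= in_itv/= andbT => x1.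
  have x0 : 0 < x := lt_le_trans ltr01 x1.
  apply: cvgV; first by rewrite expf_neq0// gt_eqF.
  exact: exprn_continuous.
- rewrite -[X in _ --> X]oppr0; apply: cvgN.
  apply/cvgrPdist_lt => e e0; near=> x.
  have x0 : 0 < x by near: x; exact: nbhs_pinfty_gt.
  rewrite sub0r normrN gtr0_norm ?invr_gt0//.
  rewrite -[ltRHS]invrK ltf_pV2 ?posrE ?invr_gt0//.
  by near: x; apply: nbhs_pinfty_gt; rewrite num_real.
- by move=> x x1; case: (dV x (lt_trans ltr01 x1)).
- exact/cvg_at_right_filter/cV.
- move=> x; rewrite in_itv/= andbT => x1; rewrite derive1E.
  by case: (dV x (lt_trans ltr01 x1)).
Unshelve. all: by end_near. Qed.

(** The two regimes met below: a power singularity at the origin and at least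
    quadratic decay at infinity. *)
Lemma integrable_itv0y (R : realType) (f : R -> R) (p A B : R) : 0 < p ->
  measurable_fun setT f -> (forall x, 0 < x -> 0 <= f x) ->
  (forall x, 0 < x <= 1 -> f x <= A * x `^ (p - 1)) ->
  (forall x, 1 <= x -> f x <= B * x `^ (- 2)) ->
  lebesgue_measure.-integrable `]0, +oo[ (EFin \o f).
Proof.
move=> p0 mf f0 fA fB.
have mfD (D : set R) : measurable_fun D (EFin \o f).
  exact/measurable_EFinP/measurable_funTS.
have mabs (D : set R) : measurable_fun D (fun x => `|(f x)%:E|%E).
  exact/measurableT_comp.
apply/integrableP; split; first exact: mfD.
have -> : `]0, +oo[%classic = `]0, 1]%classic `|` `]1, +oo[%classic :> set R.
  by rewrite -itv_bndbnd_setU// bnd_simp.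
rewrite ge0_integral_setU//=; last 2 first.
- exact: mabs.
- apply/disj_setPS => x [] /=; rewrite !in_itv/= => /andP[_ x1] /andP[].
  by rewrite ltNge x1.
have mXp : measurable_fun setT (fun x : R => x `^ (p - 1)) := measurable_powR _.
have mX2 : measurable_fun setT (fun x : R => x `^ (- 2)) := measurable_powR _.
apply: lte_add_pinfty.
- apply: (@le_lt_trans _ _
    (\int[lebesgue_measure]_(x in `]0%R, 1%R]) (`|A| * x `^ (p - 1))%:E)%E).
    apply: ge0_le_integral => //.
    + exact: mabs.
    + apply/measurable_EFinP; apply: measurable_funM => //.
      exact: measurable_funTS.
    + move=> x; rewrite /= in_itv/= => /andP[x0 x1].
      rewrite lee_fin ger0_norm ?f0// (le_trans (fA _ _)) ?x0//.
      by rewrite ler_wpM2r ?powR_ge0// ler_norm.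
  under eq_integral do rewrite EFinM.
  rewrite integral_itv_obnd_cbnd; last first.
    apply: measurable_funeM.
    exact/measurable_EFinP/measurable_funTS.
  rewrite ge0_integralZl//; last 2 first.
    exact/measurable_EFinP/measurable_funTS.
    by move=> x _; rewrite lee_fin powR_ge0.
  have -> : (\int[lebesgue_measure]_(x in `[0%R, 1%R]) (x `^ (p - 1))%:E =
      \int[lebesgue_measure]_(x in `[0%R, 1%R]) ((x - 0) `^ (p - 1))%:E)%E.
    by apply: eq_integral => x _; rewrite subr0.
  by rewrite integral_powR_addr ?lexx ?ler01// -EFinM ltry.
- apply: (@le_lt_trans _ _
    (\int[lebesgue_measure]_(x in `]1%R, +oo[) (`|B| * x `^ (- 2))%:E)%E).
    apply: ge0_le_integral => //.
    + exact: mabs.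
    + apply/measurable_EFinP; apply: measurable_funM => //.
      exact/measurable_funTS.
    + move=> x; rewrite /= in_itv/= andbT => x1.
      rewrite lee_fin ger0_norm ?f0 ?(lt_trans ltr01)//.
      rewrite (le_trans (fB _ (ltW x1)))// ler_wpM2r ?ler_norm//.
      by rewrite powR_ge0.
  under eq_integral do rewrite EFinM.
  rewrite integral_itv_obnd_cbnd; last first.
    by apply: measurable_funeM; exact/measurable_EFinP/measurable_funTS.
  rewrite ge0_integralZl//; last 2 first.
    exact/measurable_EFinP/measurable_funTS.
    by move=> x _; rewrite lee_fin powR_ge0.
  by rewrite integral_powRN2_itv1y -EFinM ltry.
Qed.

Lemma Rintegral_itv0y_gt0 (R : realType) (f : R -> R) (c : R) :
  measurable_fun setT f -> (forall x, 0 < x -> 0 <= f x) ->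
  0 < c -> (forall x, 1 <= x <= 2 -> c <= f x) ->
  lebesgue_measure.-integrable `]0, +oo[ (EFin \o f) ->
  0 < \int[lebesgue_measure]_(x in `]0, +oo[) f x.
Proof.
move=> mf f0 c0 fc intf; apply: fine_gt0.
have absE : (\int[lebesgue_measure]_(x in `]0%R, +oo[) `|(f x)%:E| =
    \int[lebesgue_measure]_(x in `]0%R, +oo[) (f x)%:E)%E.
  apply: eq_integral => x; rewrite inE/= in_itv/= andbT => x0.
  by rewrite ger0_norm ?f0.
rewrite -absE; move/integrableP : (intf) => [_ ->]; rewrite andbT absE.
apply: (@lt_le_trans _ _ (\int[lebesgue_measure]_(x in `[1%R, 2%R]) (f x)%:E)%E).
  apply: (@lt_le_trans _ _ (\int[lebesgue_measure]_(x in `[1%R, 2%R]) c%:E)%E).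
    rewrite integral_cst//= lebesgue_measure_itv/= lte_fin ltr1n -EFinD -EFinM.
    by rewrite lte_fin; lra.
  apply: ge0_le_integral => //.
  - by move=> x _; rewrite lee_fin ltW.
  - exact/measurable_EFinP/measurable_funTS.
apply: ge0_subset_integral => //.
- exact/measurable_EFinP/measurable_funTS.
- by move=> x; rewrite /= in_itv/= andbT => x0; rewrite lee_fin f0.
- by move=> x; rewrite /= !in_itv/= andbT => /andP[/(lt_le_trans ltr01)].
Qed.

(** The real-valued integral takes the value 0 on a divergent integral, hence
    positivity needs integrability besides the positivity of the integrand. *)
Lemma Gamma_gt0 (R : realType) (p : R) : 0 < p < 1 -> 0 < Gamma p.
Proof.
move=> /andP[p0 p1].
have mf : measurable_fun setT (fun s : R => s `^ (p - 1) * expR (- s)).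
  apply: measurable_funM; first exact: measurable_powR.
  by apply: measurableT_comp => //; exact: measurable_expR.
have f0 (x : R) : 0 < x -> 0 <= x `^ (p - 1) * expR (- x).
  by move=> _; rewrite mulr_ge0 ?powR_ge0// expR_ge0.
apply: (@Rintegral_itv0y_gt0 _ _ (2 `^ (p - 1) * expR (- 2))) => //.
- move=> x /andP[x1 x2]; have x0 : 0 < x := lt_le_trans ltr01 x1.
  apply: ler_pM; rewrite ?powR_ge0 ?expR_ge0// ?ler_expR ?lerN2//.
  rewrite (_ : p - 1 = - (1 - p)); last by ring.
  rewrite !powRN lef_pV2 ?posrE ?powR_gt0//.
  by apply: ge0_ler_powR => //; rewrite ?nnegrE ?(ltW x0)//; lra.
- apply: (@integrable_itv0y _ (fun x => x `^ (p - 1) * expR (- x)) p 1 4) => //.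
  + move=> x /andP[x0 x1]; rewrite mul1r ler_piMr ?powR_ge0//.
    by rewrite -expR0 ler_expR oppr_le0 ltW.
  + move=> x x1; have x0 : 0 < x := lt_le_trans ltr01 x1.
    apply: (@le_trans _ _ (expR (- x))).
      rewrite ler_piMl ?expR_ge0// (_ : p - 1 = - (1 - p)) ?powRN; last by ring.
      rewrite invf_le1 ?powR_gt0// -[leLHS](powRr0 x).
      by apply: ler_powR => //; lra.
    (* [exp x = exp (x / 2) ^ 2 >= (1 + x / 2) ^ 2 >= x ^ 2 / 4]. *)
    rewrite (powR_invn 2) ?(ltW x0)// expRN -(invrK 4) -invfM.
    rewrite lef_pV2 ?posrE ?expR_gt0 ?mulr_gt0//.
    rewrite [x in expR x]splitr expRD; have := expR_ge1Dx (x / 2) => h.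
    by apply: (@le_trans _ _ ((1 + x / 2) * (1 + x / 2))); [nra|apply: ler_pM; lra].
Qed.

(** * Powers as mixtures of cosines *)

(** Exhausts the open half-line by closed ones, as required by the change of
    variables for integrands that are singular at the origin. *)
Lemma cvg_integral_itvy (R : realType) (g : R -> R) (x : R) : 0 < x ->
  measurable_fun setT g -> (forall y, 0 < y -> 0 <= g y) ->
  (\int[lebesgue_measure]_(y in `[(x * harmonic n)%R, +oo[) (g y)%:E
     @[n --> \oo] --> \int[lebesgue_measure]_(y in `]0%R, +oo[) (g y)%:E)%E.
Proof.
move=> x0 mg g0; pose I n : set R := `[x * harmonic n, +oo[%classic.
have xh n : 0 < x * harmonic n by rewrite mulr_gt0// invr_gt0.
have -> : `]0, +oo[%classic = \bigcup_n I n.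
  apply/seteqP; split=> [y|y [n _]]; rewrite /I/= !in_itv/= !andbT; last first.
    by move=> hy; exact: lt_le_trans (xh n) hy.
  move=> y0; exists (Num.truncn (x / y)) => //.
  rewrite /I/= in_itv/= andbT /harmonic/= ler_pdivrMr// mulrC -ler_pdivrMr//.
  exact/ltW/truncnS_gt.
apply: ge0_nondecreasing_set_cvg_integral => //.
- move=> m n mn; apply/subsetPset => y; rewrite /= !in_itv/= !andbT.
  apply: le_trans; rewrite ler_pM2l// /harmonic/= lef_pV2 ?posrE//.
  by rewrite ler_nat.
- by move=> n; exact/measurable_EFinP/measurable_funTS.
- move=> n y; rewrite /= in_itv/= andbT lee_fin => hy; apply: g0.
  exact: lt_le_trans (xh n) hy.
Qed.

Lemma integral_itv0y_scale (R : realType) (g : R -> R) (x : R) : 0 < x ->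
  measurable_fun setT g -> (forall y, 0 < y -> 0 <= g y) ->
  (forall y, 0 < y -> {for y, continuous g}) ->
  (\int[lebesgue_measure]_(y in `]0%R, +oo[) (g y)%:E =
   \int[lebesgue_measure]_(y in `]0%R, +oo[) (g (x * y) * x)%:E)%E.
Proof.
move=> x0 mg g0 cg.
have mM : measurable_fun setT (fun y : R => x * y) by apply: measurable_funM.
have mgx : measurable_fun setT (fun y : R => g (x * y) * x).
  by apply: measurable_funM => //; exact: measurableT_comp.
have gx0 y : 0 < y -> 0 <= g (x * y) * x.
  by move=> y0; rewrite mulr_ge0 ?(ltW x0)// g0// mulr_gt0.
have c1 := cvg_integral_itvy x0 mg g0.
have c2 := cvg_integral_itvy ltr01 mgx gx0.
have dM (y : R) : is_derive y 1 (fun y : R => x * y) x.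
  have := is_deriveZ x (is_derive_id y 1) => dF; apply: (is_derive_eq dF).
  by rewrite /GRing.scale/= mulr1.
have d1M : (fun y : R => x * y)^`()%classic = cst x.
  by apply/funext => y; rewrite derive1E; case: (dM y).
have cM : continuous (fun y : R => x * y) by move=> y; exact: mulrl_continuous.
have E n : (\int[lebesgue_measure]_(y in `[(x * harmonic n)%R, +oo[) (g y)%:E =
    \int[lebesgue_measure]_(y in `[(1 * harmonic n)%R, +oo[) (g (x * y) * x)%:E)%E.
  have h0 : 0 < harmonic n :> R by rewrite invr_gt0.
  rewrite mul1r (@increasing_ge0_integration_by_substitutiony _ (fun y => x * y)).
  - by rewrite d1M.
  - by move=> y z _ _ yz; rewrite ltr_pM2l.
  - by rewrite d1M => y _; exact: cst_continuous.
  - by rewrite d1M; exact: is_cvg_cst.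
  - by rewrite d1M; exact: is_cvg_cst.
  - split; first by move=> y _; case: (dM y).
    exact/cvg_at_right_filter/cM.
  - by apply: gt0_cvgMry => //; exact: cvg_id.
  - apply: continuous_in_subspaceT => y; rewrite inE/= in_itv/= andbT => hy.
    by apply: cg; rewrite (lt_le_trans _ hy)// mulr_gt0.
  - move=> y; rewrite in_itv/= andbT => hy.
    by apply: g0; rewrite (lt_trans _ hy)// mulr_gt0.
move: c1; under eq_cvg do rewrite E.
by move=> c1; apply: cvg_unique c1 c2.
Qed.

Lemma onem_cos_le_sqr (R : realType) (y : R) : 1 - cos y <= y ^+ 2.
Proof.
have sin_le (z : R) : 0 < z -> `|sin z| <= z.
  move=> z0; have [|c _] := @MVT R sin cos 0 z z0 (fun c _ => is_derive_sin c).
    by apply: continuous_subspaceT; exact: continuous_sin.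
  rewrite sin0 !subr0 => ->; rewrite normrM (gtr0_norm z0) ler_piMl ?(ltW z0)//.
  exact: cos_max.
have sin2_le (z : R) : sin z ^+ 2 <= z ^+ 2.
  have [->|z0] := eqVneq z 0; first by rewrite sin0.
  rewrite -real_normK ?num_real// -[leRHS]real_normK ?num_real//.
  rewrite ler_pXn2r ?nnegrE//.
  have [zp|zn|/eqP] := ltgtP 0 z; last by rewrite eq_sym (negbTE z0).
    by rewrite (gtr0_norm zp) sin_le.
  rewrite (ltr0_norm zn) -normrN -sinN sin_le//; lra.
rewrite [y in cos y](_ : y = (y / 2) *+ 2); last by rewrite mulr2n -splitr.
rewrite cos_mulr2n cos2sin2 mulr2n; have := sin2_le (y / 2).
have := sqr_ge0 y; lra.
Qed.

(** The density in [y] of the cosine mixture that represents the power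
    [|x| ^ g]. *)
Definition cos_density (R : realType) (g x y : R) : R :=
  (1 - cos (y * x)) * y `^ (- 1 - g).

Section cosine_mixture.
Context (R : realType) (g : R).
Hypothesis g12 : 1 < g < 2.

Lemma measurable_cos_density x : measurable_fun setT (cos_density g x).
Proof.
apply: measurable_funM; last exact: measurable_powR.
apply: measurable_funB => //.
apply: (measurableT_comp (continuous_measurable_fun (@continuous_cos R))).
exact: measurable_funM.
Qed.

Lemma cos_density_ge0 x y : 0 <= cos_density g x y.
Proof. by rewrite mulr_ge0 ?powR_ge0// subr_ge0 cos_le1. Qed.

(** Near the origin [1 - cos] is quadratic, which is where [g < 2] is used. *)
Lemma integrable_cos_density x :
  lebesgue_measure.-integrable `]0, +oo[ (EFin \o cos_density g x).
Proof.
move/andP: g12 => [g1 g2].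
apply: (@integrable_itv0y _ (cos_density g x) (2 - g) (x ^+ 2) 2).
(* At the origin [y ^ 2 * y ^ (- 1 - g) = y ^ ((2 - g) - 1)]. *)
- by rewrite subr_gt0.
- exact: measurable_cos_density.
- by move=> y _; exact: cos_density_ge0.
- move=> y /andP[y0 _]; apply: (@le_trans _ _ ((y * x) ^+ 2 * y `^ (- 1 - g))).
    by rewrite ler_wpM2r ?powR_ge0// onem_cos_le_sqr.
  rewrite exprMn [y ^+ 2 * _]mulrC -mulrA -(powR_mulrn 2 (ltW y0)).
  rewrite -powRD; last by rewrite (gt_eqF y0) implybT.
  by rewrite (_ : 2 + (- 1 - g) = 2 - g - 1)//; ring.
- move=> y y1; apply: ler_pM; rewrite ?subr_ge0 ?cos_le1 ?powR_ge0//.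
    by have := cos_geN1 (y * x); lra.
  by apply: ler_powR => //; lra.
Qed.

Lemma Rintegral_cos_density1_gt0 :
  0 < \int[lebesgue_measure]_(y in `]0, +oo[) cos_density g 1 y.
Proof.
move/andP: g12 => [g1 g2].
have c1 : cos 1 < 1 :> R.
  rewrite -[ltRHS]cos0 ltr_cos ?ltr01// in_itv/= ?lexx ?ler01 ?pi_ge0//=.
  by rewrite (le_trans _ (pi_ge2 R))// ler1n.
apply: (@Rintegral_itv0y_gt0 _ _ ((1 - cos 1) * 2 `^ (- 1 - g))).
- exact: measurable_cos_density.
- by move=> y _; exact: cos_density_ge0.
- by rewrite mulr_gt0 ?subr_gt0 ?powR_gt0.
- move=> y /andP[y1 y2]; have y0 : 0 < y := lt_le_trans ltr01 y1.
  have ypi : y <= pi := le_trans y2 (pi_ge2 R).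
  apply: ler_pM; rewrite ?powR_ge0 ?subr_ge0 ?(ltW c1)//.
    rewrite mulr1 lerD2l lerN2 leNgt ltr_cos -?leNgt// in_itv/=.
      by rewrite (ltW y0).
    by rewrite ler01 (le_trans y1).
  rewrite (_ : - 1 - g = - (1 + g)); last by ring.
  rewrite !powRN lef_pV2 ?posrE ?powR_gt0//.
  by apply: ge0_ler_powR => //; rewrite ?nnegrE ?(ltW y0)//; lra.
- exact: integrable_cos_density.
Qed.

(** Homogeneity: the substitution [y -> |x| y] takes the integral for [x] to
    the one for 1. *)
Lemma Rintegral_cos_density x :
  \int[lebesgue_measure]_(y in `]0, +oo[) cos_density g x y =
  `|x| `^ g * \int[lebesgue_measure]_(y in `]0, +oo[) cos_density g 1 y.
Proof.
move/andP: g12 => [g1 g2]; have g0 : 0 < g := lt_trans ltr01 g1.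
have [->|x0] := eqVneq x 0.
  rewrite normr0 powR0 ?gt_eqF// mul0r.
  rewrite (@eq_Rintegral _ _ _ _ _ (fun=> 0)) ?Rintegral_cst ?mul0r//.
  by move=> y _; rewrite /cos_density mulr0 cos0 subrr mul0r.
have ax0 : 0 < `|x| by rewrite normr_gt0.
rewrite -[RHS]RintegralZl//; last exact: integrable_cos_density.
rewrite /Rintegral; congr fine.
rewrite (@integral_itv0y_scale _ (fun y => `|x| `^ g * cos_density g 1 y) `|x|)//.
- apply: eq_integral => y; rewrite inE/= in_itv/= andbT => y0; congr EFin.
  have cosE : cos (`|x| * y) = cos (y * x).
    by rewrite -[in LHS](gtr0_norm y0) -normrM cos_norm mulrC.
  have powE : `|x| `^ g * `|x| `^ (- 1 - g) * `|x| = 1.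
    rewrite -[X in _ * X](powRr1 (ltW ax0)) -!powRD ?(gt_eqF ax0) ?implybT//.
    by have -> : g + (- 1 - g) + 1 = 0 :> R; [lra|exact: powRr0].
  rewrite /cos_density mulr1 cosE powRM ?(ltW y0) ?(ltW ax0)//.
  rewrite -[LHS]mulr1 -[X in _ * X = _]powE; ring.
- apply: measurable_funM => //; exact: measurable_cos_density.
- by move=> y y0; rewrite mulr_ge0 ?powR_ge0// cos_density_ge0.
- move=> y y0; apply: cvgMl_tmp; apply: cvgM.
    apply: cvgB; first exact: cvg_cst.
    under eq_cvg do rewrite mulr1.
    rewrite mulr1; exact: continuous_cos.
  suff : {for y, continuous (@powR R ^~ (- 1 - g))} by [].
  apply/differentiable_continuous/derivable1_diffP.
  by case: (is_derive_powR (- 1 - g) y0).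
Qed.

End cosine_mixture.

(** * Positivity of the increments of a power *)

Section Rintegral_sums.
Context d (T : measurableType d) (R : realType).
Context (mu : {measure set T -> \bar R}) (D : set T) (mD : measurable D).
Context (I : Type) (F : I -> T -> R).
Hypothesis intF : forall i, mu.-integrable D (EFin \o F i).

Lemma integrable_sumr (s : seq I) :
  mu.-integrable D (EFin \o (fun x => \sum_(i <- s) F i x)).
Proof.
have := @integrable_sum _ _ _ mu D mD I s xpredT _ (fun i _ => intF i).
by apply: eq_integrable => // x _; rewrite /= sumEFin.
Qed.

Lemma Rintegral_sum (s : seq I) :
  \int[mu]_(x in D) (\sum_(i <- s) F i x) =
  \sum_(i <- s) \int[mu]_(x in D) F i x.
Proof.
elim: s => [|i s IH].
  rewrite big_nil; under eq_Rintegral do rewrite big_nil.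
  by rewrite Rintegral_cst// mul0r.
rewrite big_cons -IH -RintegralD//; last exact: integrable_sumr.
by apply: eq_Rintegral => x _; rewrite big_cons.
Qed.

End Rintegral_sums.

Section power_kernel.
Context (R : realType) (g : R).
Implicit Types (t W : nat -> R).

(** Minus the mixed second difference of [|r - s| ^ g] over the mesh cells [n]
    and [k]; up to a constant, the double integral of [|r - s| ^ (g - 2)] over
    the product of the two cells. *)
Definition pow_incr t n k : R :=
  `|t n - t k.-1| `^ g - `|t n.-1 - t k.-1| `^ g
  - `|t n - t k| `^ g + `|t n.-1 - t k| `^ g.

Lemma pow_incrC t n k : pow_incr t n k = pow_incr t k n.
Proof.
rewrite /pow_incr (distrC (t n)) (distrC (t n.-1)) (distrC (t n)).
rewrite (distrC (t n.-1) (t k)); ring.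
Qed.

(** The cosine representation makes the form an integral over [y] of
    [(sum_n W_n (cos (y t_n) - cos (y t_(n-1)))) ^ 2] plus its analogue for the
    sine. *)
Lemma pow_incr_psd t W (s : seq nat) : 1 < g < 2 ->
  0 <= \sum_(n <- s) \sum_(k <- s) pow_incr t n k * (W n * W k).
Proof.
move=> g12; pose K := \int[lebesgue_measure]_(y in `]0, +oo[) cos_density g 1 y.
have K0 : 0 < K := Rintegral_cos_density1_gt0 g12.
have KE x : \int[lebesgue_measure]_(y in `]0, +oo[) cos_density g x y = `|x| `^ g * K.
  exact: Rintegral_cos_density.
(* From here on [K] is known only through its sign and [KE]. *)
move: K K0 KE => K K0 KE.
rewrite -(pmulr_rge0 _ K0).
pose e n k (y : R) := cos_density g (t n - t k.-1) y - cos_density g (t n.-1 - t k.-1) y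
  - cos_density g (t n - t k) y + cos_density g (t n.-1 - t k) y.
have iB (f h : R -> R) : lebesgue_measure.-integrable `]0, +oo[ (EFin \o f) ->
    lebesgue_measure.-integrable `]0, +oo[ (EFin \o h) ->
    lebesgue_measure.-integrable `]0, +oo[ (EFin \o (fun y => f y - h y)).
  by move=> intf inth; apply: (integrableB _ intf inth).
have iK x := integrable_cos_density g12 x.
have inte n k : lebesgue_measure.-integrable `]0, +oo[ (EFin \o e n k).
  exact: (integrableD _ (iB _ _ (iB _ _ (iK _) (iK _)) (iK _)) (iK _)).
have intE n k : \int[lebesgue_measure]_(y in `]0, +oo[) e n k y =
    K * pow_incr t n k.
  rewrite (RintegralD _ (iB _ _ (iB _ _ (iK _) (iK _)) (iK _)) (iK _))//.
  rewrite (RintegralB _ (iB _ _ (iK _) (iK _)) (iK _))//.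
  rewrite (RintegralB _ (iK _) (iK _))//.
  rewrite !KE /pow_incr; ring.
pose E n k y := W n * W k * e n k y.
have intEn n k : lebesgue_measure.-integrable `]0, +oo[ (EFin \o E n k).
  exact: (integrableZl _ (W n * W k) (inte n k)).
have -> : K * (\sum_(n <- s) \sum_(k <- s) pow_incr t n k * (W n * W k)) =
    \int[lebesgue_measure]_(y in `]0, +oo[)
      (\sum_(n <- s) \sum_(k <- s) E n k y).
  rewrite Rintegral_sum//; last by move=> n; exact: integrable_sumr.
  rewrite mulr_sumr; apply: eq_bigr => n _.
  rewrite Rintegral_sum// mulr_sumr; apply: eq_bigr => k _.
  rewrite RintegralZl// intE; ring.
apply: Rintegral_ge0 => y _.
pose p n := W n * (cos (y * t n) - cos (y * t n.-1)).
pose q n := W n * (sin (y * t n) - sin (y * t n.-1)).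
have -> : \sum_(n <- s) \sum_(k <- s) E n k y =
    y `^ (- 1 - g) * ((\sum_(n <- s) p n) ^+ 2 + (\sum_(n <- s) q n) ^+ 2).
  rewrite !expr2 !big_distrlr -big_split mulr_sumr; apply: eq_bigr => n _.
  rewrite -big_split mulr_sumr; apply: eq_bigr => k _ /=.
  rewrite /E /e /cos_density /p /q !mulrBr !cosB; ring.
by rewrite mulr_ge0 ?powR_ge0// addr_ge0 ?sqr_ge0.
Qed.

(** The causal form sees each pair of cells once, and half of the diagonal: by
    symmetry it is half of the full form. *)
Lemma pow_incr_tri_psd t W m : 1 < g < 2 ->
  0 <= \sum_(1 <= n < m.+1) \sum_(1 <= k < n.+1)
         (if k == n then 2^-1 else 1) * pow_incr t n k * (W n * W k).
Proof.
move=> g12; set S := (X in 0 <= X).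
suff -> : S = 2^-1 * \sum_(1 <= n < m.+1) \sum_(1 <= k < m.+1)
                 pow_incr t n k * (W n * W k).
  by rewrite mulr_ge0// pow_incr_psd.
rewrite /S {S}; elim: m => [|m IH]; first by rewrite !big_geq// mulr0.
rewrite big_nat_recr//= IH [in RHS]big_nat_recr//=.
have -> : \sum_(1 <= i < m.+1) \sum_(1 <= k < m.+2) pow_incr t i k * (W i * W k) =
  \sum_(1 <= i < m.+1) \sum_(1 <= k < m.+1) pow_incr t i k * (W i * W k) +
  \sum_(1 <= i < m.+1) pow_incr t m.+1 i * (W m.+1 * W i).
  rewrite -big_split; apply: eq_bigr => i _; rewrite big_nat_recr//=.
  by rewrite pow_incrC (mulrC (W i)).
rewrite !(@big_nat_recr _ _ _ m.+1)//= eqxx.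
have -> : \sum_(1 <= k < m.+1)
      (if k == m.+1 then 2^-1 else 1) * pow_incr t m.+1 k * (W m.+1 * W k) =
    \sum_(1 <= k < m.+1) pow_incr t m.+1 k * (W m.+1 * W k).
  by apply: eq_big_nat => k /andP[_ km]; rewrite (ltn_eqF km) mul1r.
by field.
Qed.

End power_kernel.

(** * The L1+ coefficients *)

Lemma ge0_integrable_fin d (T : measurableType d) (R : realType)
    (mu : {measure set T -> \bar R}) (D : set T) (f : T -> R) (v : R) :
  measurable D -> measurable_fun D f -> (forall x, D x -> 0 <= f x) ->
  (\int[mu]_(x in D) (f x)%:E = v%:E)%E -> mu.-integrable D (EFin \o f).
Proof.
move=> mD mf f0 fv; apply/integrableP; split; first exact/measurable_EFinP.
have -> : (\int[mu]_(x in D) `|(f x)%:E| = \int[mu]_(x in D) (f x)%:E)%E.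
  by apply: eq_integral => x /[!inE] xD; rewrite /= ger0_norm ?f0.
by rewrite fv ltry.
Qed.

Section L1plus_coefficients.
Context (R : realType) (alpha : R) (t : nat -> R).
Hypothesis alpha01 : 0 < alpha < 1.

(** The constant left by integrating [omega (1 - alpha)] twice. *)
Definition L1plus_const : R := (Gamma (1 - alpha) * (1 - alpha) * (2 - alpha))^-1.

Lemma L1plus_const_gt0 : 0 < L1plus_const.
Proof.
move/andP: alpha01 => [a0 a1].
by rewrite invr_gt0 !mulr_gt0 ?Gamma_gt0//; lra.
Qed.

Lemma Rintegral_omega (r c e : R) : c <= e <= r ->
  \int[lebesgue_measure]_(s in `[c, e]) omega (1 - alpha) (r - s) =
  ((r - c) `^ (1 - alpha) - (r - e) `^ (1 - alpha))
    / (1 - alpha) / Gamma (1 - alpha).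
Proof.
move/andP: alpha01 => [a0 a1] cer; have p0 : 0 < 1 - alpha by lra.
have iE := integral_powR_subr p0 cer.
rewrite /omega RintegralZr//; first by rewrite /Rintegral iE.
apply: ge0_integrable_fin iE => //; last by move=> x _; exact: powR_ge0.
apply: measurable_funTS.
have mg : measurable_fun setT (fun s : R => r - s) by apply: measurable_funB.
exact: (measurableT_comp (@measurable_powR R (1 - alpha - 1)) mg).
Qed.

Lemma integrable_powR_addr (a c e : R) : a <= c <= e ->
  lebesgue_measure.-integrable `[c, e] (EFin \o (fun r => (r - a) `^ (1 - alpha))).
Proof.
move/andP: alpha01 => [a0 a1] ace; have p0 : 0 < 2 - alpha by lra.
have := integral_powR_addr p0 ace.
rewrite (_ : 2 - alpha - 1 = 1 - alpha); last by ring.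
apply: ge0_integrable_fin => //; last by move=> x _; exact: powR_ge0.
apply: measurable_funTS.
have mg : measurable_fun setT (fun s : R => s - a) by apply: measurable_funB.
exact: (measurableT_comp (@measurable_powR R (1 - alpha)) mg).
Qed.

Lemma Rintegral_powR_addr (a c e : R) : a <= c <= e ->
  \int[lebesgue_measure]_(r in `[c, e]) (r - a) `^ (1 - alpha) =
  ((e - a) `^ (2 - alpha) - (c - a) `^ (2 - alpha)) / (2 - alpha).
Proof.
move/andP: alpha01 => [a0 a1] ace; have p0 : 0 < 2 - alpha by lra.
have := integral_powR_addr p0 ace.
by rewrite (_ : 2 - alpha - 1 = 1 - alpha) /Rintegral => [->//|]; ring.
Qed.

(** The inner integral stops at [r], so only half of the square of the cell
    contributes. *)
Lemma L1plus_coef_diagE n : t n.-1 <= t n ->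
  L1plus_coef alpha t n n =
  L1plus_const * 2^-1 * pow_incr (2 - alpha) t n n / (tau t n * tau t n).
Proof.
move=> tn; move/andP: alpha01 => [a0 a1].
rewrite /L1plus_coef mulrC.
congr (_ / _).
transitivity (\int[lebesgue_measure]_(r in `[t n.-1, t n])
    ((Gamma (1 - alpha) * (1 - alpha))^-1 * (r - t n.-1) `^ (1 - alpha))).
  apply: eq_Rintegral => r; rewrite inE/= in_itv/= => /andP[r1 r2].
  rewrite min_l// Rintegral_omega ?r1 ?lexx// subrr powR0 ?subr0; last lra.
  by rewrite invfM mulrC mulrA mulrAC.
rewrite RintegralZl//; last by apply: integrable_powR_addr; rewrite lexx.
rewrite Rintegral_powR_addr ?lexx//.
rewrite /pow_incr !subrr normr0 powR0; last lra.
rewrite (distrC (t n.-1)) ger0_norm ?subr_ge0// !subr0 /L1plus_const !invfM.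
move: (Gamma _)^-1 (_ `^ _) => G P.
have half_double : 2^-1 * (P + P) = P by field.
by rewrite -[RHS]mulrA half_double; ring.
Qed.

Lemma L1plus_coef_ltnE n k : t k.-1 <= t k -> t k <= t n.-1 -> t n.-1 <= t n ->
  L1plus_coef alpha t n k =
  L1plus_const * pow_incr (2 - alpha) t n k / (tau t n * tau t k).
Proof.
move=> tk tkn tn; move/andP: alpha01 => [a0 a1].
rewrite /L1plus_coef mulrC; congr (_ / _).
transitivity (\int[lebesgue_measure]_(r in `[t n.-1, t n])
    ((Gamma (1 - alpha) * (1 - alpha))^-1 *
     ((r - t k.-1) `^ (1 - alpha) - (r - t k) `^ (1 - alpha)))).
  apply: eq_Rintegral => r; rewrite inE/= in_itv/= => /andP[r1 r2].
  rewrite min_r ?(le_trans tkn)// Rintegral_omega ?tk ?(le_trans tkn)//.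
  by rewrite invfM mulrC mulrA mulrAC.
have i1 : lebesgue_measure.-integrable `[t n.-1, t n]
    (EFin \o (fun r => (r - t k.-1) `^ (1 - alpha))).
  by apply: integrable_powR_addr; rewrite (le_trans tk).
have i2 : lebesgue_measure.-integrable `[t n.-1, t n]
    (EFin \o (fun r => (r - t k) `^ (1 - alpha))).
  by apply: integrable_powR_addr; rewrite tkn.
rewrite RintegralZl//; last exact: (integrableB _ i1 i2).
rewrite (RintegralB _ i1 i2)//.
have tk_n1 := le_trans tk tkn; have tk_n := le_trans tkn tn.
have tk1_n := le_trans tk tk_n.
rewrite !Rintegral_powR_addr ?tk_n1 ?tkn//.
rewrite /pow_incr !ger0_norm ?subr_ge0//.
rewrite /L1plus_const !invfM; move: (Gamma _)^-1 => G; ring.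
Qed.

End L1plus_coefficients.

Section L1plus_positivity.
Context (R : realType) (alpha : R) (t : nat -> R) (m : nat).
Hypothesis alpha01 : 0 < alpha < 1.
Hypothesis t_incr : forall k, (k < m)%N -> t k < t k.+1.

Lemma mesh_le i j : (i <= j <= m)%N -> t i <= t j.
Proof.
move=> /andP[ij jm]; elim: j ij jm => [|j IH].
  by rewrite leqn0 => /eqP ->.
rewrite leq_eqVlt => /predU1P[->//|ij jm].
by rewrite (le_trans (IH _ _))// ?ltW ?t_incr// ltnW.
Qed.

Lemma mesh_step_gt0 n : (1 <= n <= m)%N -> 0 < tau t n.
Proof. by case: n => // n /= nm; rewrite subr_gt0 t_incr. Qed.

(** Makes the L1+ formula an invertible triangular system, the key to the
    conservation of mass. *)
Lemma L1plus_coef_diag_gt0 n : (1 <= n <= m)%N -> 0 < L1plus_coef alpha t n n.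
Proof.
move=> nm; have := mesh_step_gt0 nm; rewrite /tau => tn.
rewrite L1plus_coef_diagE//; last by rewrite -subr_ge0 ltW.
rewrite divr_gt0 ?mulr_gt0 ?L1plus_const_gt0//.
rewrite /pow_incr !subrr normr0 powR0; last by move/andP: alpha01 => [_ ?]; lra.
by rewrite !subr0 (distrC (t n.-1)) addr_gt0// powR_gt0// normr_gt0 gt_eqF.
Qed.

(** Dividing the weights by the time steps absorbs the normalization of the
    coefficients and leaves the form of [pow_incr] on an arbitrary mesh. *)
Lemma L1plus_psd (w : nat -> R) :
  0 <= \sum_(1 <= n < m.+1)
         (\sum_(1 <= k < n.+1) L1plus_coef alpha t n k * w k) * w n.
Proof.
have g12 : 1 < 2 - alpha < 2 by move/andP: alpha01 => [? ?]; apply/andP; split; lra.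
have := pow_incr_tri_psd t (fun n => w n / tau t n) m g12.
rewrite -(pmulr_rge0 _ (L1plus_const_gt0 alpha01)); congr (0 <= _).
rewrite mulr_sumr; apply: eq_big_nat => n /andP[n1 nm].
rewrite mulr_sumr mulr_suml; apply: eq_big_nat => k /andP[k1 kn].
have tn1 : t n.-1 <= t n by apply: mesh_le; rewrite leq_pred.
have -> : L1plus_coef alpha t n k = L1plus_const alpha *
    (if k == n then 2^-1 else 1) * pow_incr (2 - alpha) t n k / (tau t n * tau t k).
  case: eqP => [->|/eqP kn']; first by rewrite L1plus_coef_diagE.
  have {}kn : (k < n)%N by rewrite ltn_neqAle kn'.
  have kn1 : (k <= n.-1)%N by rewrite -ltnS prednK.
  rewrite mulr1 L1plus_coef_ltnE//; apply: mesh_le.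
    by rewrite leq_pred (leq_trans kn1)// (leq_trans (leq_pred _)).
  by rewrite kn1 (leq_trans (leq_pred _)).
by rewrite invfM; ring.
Qed.

End L1plus_positivity.

(** * Continuous functions on a box *)

Section box_measure.
Context (R : realType).

Lemma tuple_boxE d (a b : 'rV[R]_d) :
  @tuple_row R d @^-1` box a b =
  \bigcap_(i in [set: 'I_d]) ((@tnth d R ^~ i) @^-1` `]a ord0 i, b ord0 i[).
Proof.
apply/seteqP; split => t /= ht.
  by move=> i _ /=; have := ht i; rewrite mxE in_itv.
by move=> i; have := ht i I; rewrite /= mxE in_itv.
Qed.

Lemma measurable_box d (a b : 'rV[R]_d) : measurable (@tuple_row R d @^-1` box a b).
Proof.
rewrite tuple_boxE; apply: fin_bigcap_measurable; first exact: finite_finset.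
move=> i _; rewrite -[X in measurable X]setTI.
exact: (@measurable_tnth _ _ d i).
Qed.

(** An open set is the union of the countably many rational boxes that it
    contains, and boxes are measurable for the product sigma-algebra. *)
Lemma measurable_tuple_row d (f : 'rV[R]_d -> R) : continuous f ->
  measurable_fun setT (f \o @tuple_row R d).
Proof.
move=> cf; apply: (measurability _ (RGenOpens.measurableE R)).
move=> _ [_ [y [z ->] <-]]; rewrite setTI comp_preimage.
have : open (f @^-1` `]y, z[) by apply: open_comp => //; exact: interval_open.
move: (f @^-1` _) => U oU.
(* Pairs of rational corners form a countable type; a box that is not
   contained in [U] contributes the empty set to the union. *)
pose Q (pq : {ffun 'I_d -> rat} * {ffun 'I_d -> rat}) : set 'rV[R]_d :=
  box (\row_i ratr (pq.1 i)) (\row_i ratr (pq.2 i)).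
have -> : U = \bigcup_(pq in [set: {ffun 'I_d -> rat} * {ffun 'I_d -> rat}])
    (if `[< Q pq `<=` U >] then Q pq else set0).
  apply/seteqP; split => x; last first.
    by move=> [pq _]; case: ifPn => // /asboolP; apply.
  move=> Ux; have /nbhs_ballP[e /= e0 xeU] := open_nbhs_nbhs (conj oU Ux).
  have /choice[p xp] (i : 'I_d) : exists q : rat, x ord0 i - e < ratr q < x ord0 i.
    have [|q] := @rat_in_itvoo R (x ord0 i - e) (x ord0 i).
      by rewrite ltrBlDr ltrDl.
    by rewrite in_itv /= => ?; exists q.
  have /choice[q xq] (i : 'I_d) : exists q : rat, x ord0 i < ratr q < x ord0 i + e.
    have [|q] := @rat_in_itvoo R (x ord0 i) (x ord0 i + e).
      by rewrite ltrDl.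
    by rewrite in_itv /= => ?; exists q.
  exists ([ffun i => p i], [ffun i => q i]) => //.
  have Qx : Q ([ffun i => p i], [ffun i => q i]) x.
    move=> i; rewrite !mxE !ffunE.
    by have /andP[_ ->] := xp i; have /andP[-> _] := xq i.
  rewrite asboolT// => y' Qy; apply: xeU; split=> // i j; rewrite ord1.
  have := Qy j; rewrite !mxE !ffunE => /andP[h1 h2].
  have /andP[h3 h4] := xp j; have /andP[h5 h6] := xq j.
  by rewrite /ball/= ltr_distlC; apply/andP; split; lra.
rewrite preimage_bigcup; apply: countable_bigcupT_measurable => //.
by move=> pq; case: ifP => _; [exact: measurable_box|rewrite preimage_set0].
Qed.

(** The open box lies in a compact closed one. *)
Lemma bounded_box d (a b : 'rV[R]_d) (f : 'rV[R]_d -> R) : continuous f ->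
  exists M, forall x, box a b x -> `|f x| <= M.
Proof.
move=> cf; pose A i := `[a ord0 i, b ord0 i]%classic.
pose C := [set x : 'rV[R]_d | forall i, A i (x ord0 i)].
have cC : compact C.
  by apply: (@rV_compact R d A) => i; exact: segment_compact.
have [M [_ hM]] :=
  compact_bounded (continuous_compact (continuous_subspaceT cf) cC).
exists (M + 1) => x abx; apply: (hM (M + 1)); first by rewrite ltrDl.
exists x => // i; rewrite /A/= in_itv/=; have /andP[/ltW -> /ltW ->] := abx i.
by [].
Qed.

Definition cons_row d (x : R) (v : 'rV[R]_d) : 'rV[R]_d.+1 :=
  \row_i oapp (v ord0) x (unlift ord0 i).

Lemma tuple_row_cons d (x : R) (t : d.-tuple R) :
  tuple_row (tuple_cons (x, t)) = cons_row x (tuple_row t).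
Proof.
apply/rowP => i; rewrite !mxE; case: unliftP => [j|] ->/=; last by rewrite tnth0.
by rewrite mxE tnthS.
Qed.

Definition tail_row d (a : 'rV[R]_d.+1) : 'rV[R]_d := \row_i a ord0 (lift ord0 i).

Lemma box_cons d (a b : 'rV[R]_d.+1) :
  @tuple_cons R d @^-1` (@tuple_row R d.+1 @^-1` box a b) =
  `]a ord0 ord0, b ord0 ord0[%classic `*`
     (@tuple_row R d @^-1` box (tail_row a) (tail_row b)).
Proof.
apply/seteqP; split => -[x t]; rewrite /preimage/= tuple_row_cons.
  move=> h; split=> /=.
    by have := h ord0; rewrite /= mxE unlift_none in_itv.
  by move=> i; have := h (lift ord0 i); rewrite !mxE liftK/= mxE.
move=> [/= h1 h2] i; rewrite mxE; case: unliftP => [j|] -> /=.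
  by have := h2 j; rewrite !mxE.
by move: h1; rewrite in_itv.
Qed.

Lemma lebesgue_box_gt0_lty d (a b : 'rV[R]_d) :
  (forall i, a ord0 i < b ord0 i) ->
  (0 < lebesgue_tuple R d (@tuple_row R d @^-1` box a b) < +oo)%E.
Proof.
elim: d a b => [|d IH] a b ab.
  rewrite (_ : _ @^-1` _ = setT); last by apply/seteqP; split=> // t _ [].
  by rewrite /= /lebesgue_tuple0 diracT lte01 ltry.
rewrite /= /lebesgue_tupleS /pushforward box_cons product_measure1E//; last first.
  exact: measurable_box.
have /andP[h1 h2] : (0 < lebesgue_tuple R d
    (@tuple_row R d @^-1` box (tail_row a) (tail_row b)) < +oo)%E.
  by apply: IH => i; rewrite !mxE.
have itvE : lebesgue_measure (`]a ord0 ord0, b ord0 ord0[%classic : set R) =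
    (b ord0 ord0 - a ord0 ord0)%:E.
  by rewrite lebesgue_measure_itv/= lte_fin ab -EFinD.
rewrite [X in (_ < X * _ < _)%E](_ : _ = (b ord0 ord0 - a ord0 ord0)%:E);
  last exact: itvE.
apply/andP; split; first by rewrite mule_gt0// lte_fin subr_gt0.
by rewrite lte_mul_pinfty// ?lee_fin ?subr_ge0 ?ltW// .
Qed.

Lemma integrable_box d (a b : 'rV[R]_d) (f : 'rV[R]_d -> R) :
  (forall i, a ord0 i < b ord0 i) -> continuous f ->
  (lebesgue_tuple R d).-integrable (@tuple_row R d @^-1` box a b)
    (EFin \o (f \o @tuple_row R d)).
Proof.
move=> ab cf; apply: measurable_bounded_integrable.
- exact: measurable_box.
- by have /andP[] := lebesgue_box_gt0_lty ab.
- exact: measurable_funTS (measurable_tuple_row cf).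
- have [M hM] := bounded_box a b cf.
  exists M; split=> [|y My t abt /=]; first exact: num_real.
  by rewrite (le_trans (hM _ abt))// ltW.
Qed.

End box_measure.

(** * Fubini on a box and integrals of periodic derivatives *)

Section periodic_divergence.
Context (R : realType).

Lemma continuous_to_rV (T : topologicalType) d (f : T -> 'rV[R]_d) :
  (forall j, continuous (fun x => f x ord0 j)) -> continuous f.
Proof.
move=> cf x; apply/cvg_ballP => e e0.
have H : \forall y \near x, forall j, ball (f x ord0 j) e (f y ord0 j).
  by apply: filter_forall => j; move/cvg_ballP : (cf j x); apply.
by apply: filterS H => y fxy; split=> // i j; rewrite ord1.
Qed.

Lemma continuous_cons_rowr d (x : R) : continuous (@cons_row R d x).
Proof.
apply: continuous_to_rV => j.
have -> : (fun v : 'rV[R]_d => cons_row x v ord0 j) =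
    (fun v => oapp (v ord0) x (unlift ord0 j)).
  by apply/funext => v; rewrite mxE.
case: unliftP => [k|] _ /=; last exact: cst_continuous.
exact: coord_continuous.
Qed.

Lemma continuous_cons_rowl d (v : 'rV[R]_d) : continuous (fun x : R => cons_row x v).
Proof.
apply: continuous_to_rV => j.
have -> : (fun x => cons_row x v ord0 j) =
    (fun x => oapp (v ord0) x (unlift ord0 j)).
  by apply/funext => x; rewrite mxE.
case: unliftP => [k|] _ /=; first exact: cst_continuous.
by move=> x; exact: cvg_id.
Qed.

Lemma cons_row_addr d (x h : R) (v : 'rV[R]_d) j :
  cons_row x (h *: unit_row R j + v) = h *: unit_row R (lift ord0 j) + cons_row x v.
Proof.
apply/rowP => i; rewrite !mxE; case: unliftP => [k|] -> /=.
  by rewrite !mxE/= (inj_eq lift_inj).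
by rewrite mulr0 add0r.
Qed.

Lemma cons_row_addl d (x h : R) (v : 'rV[R]_d) :
  cons_row (h + x) v = h *: unit_row R ord0 + cons_row x v.
Proof.
apply/rowP => i; rewrite !mxE; case: unliftP => [k|] -> /=.
  by rewrite mulr0 add0r.
by rewrite mulr1.
Qed.

(** A directional derivative depends only on the restriction of the function to
    a line; used to pass from [f] to its slices. *)
Lemma is_derive_line (V W : normedModType R) (f : V -> R) (k : W -> R)
    (x v : V) (y w : W) (df : R) :
  (forall h : R, k (h *: w + y) = f (h *: v + x)) ->
  is_derive x v f df -> is_derive y w k df.
Proof.
move=> kf [dfx <-].
have E : (fun h : R => h^-1 *: (k (h *: w + y) - k y)) =
    (fun h : R => h^-1 *: (f (h *: v + x) - f x)).
  by apply/funext => h; rewrite kf; have := kf 0; rewrite !scale0r !add0r => ->.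
by split; rewrite /derivable /derive E.
Qed.

(** Both orders of integration between the first coordinate and the others are
    needed: the inner integral must run over the direction that is
    differentiated, or over a slice that contains it. *)
Lemma integral_box_cons d (a b : 'rV[R]_d.+1) (f : 'rV[R]_d.+1 -> R) :
  (forall i, a ord0 i < b ord0 i) -> continuous f ->
  (\int[lebesgue_tuple R d.+1]_(t in @tuple_row R d.+1 @^-1` box a b)
     (f (tuple_row t))%:E =
   \int[lebesgue_measure]_(x in `]a ord0 ord0, b ord0 ord0[)
     \int[lebesgue_tuple R d]_(t in @tuple_row R d @^-1` box (tail_row a) (tail_row b))
        (f (cons_row x (tuple_row t)))%:E)%E /\
  (\int[lebesgue_tuple R d.+1]_(t in @tuple_row R d.+1 @^-1` box a b)
     (f (tuple_row t))%:E =
   \int[lebesgue_tuple R d]_(t in @tuple_row R d @^-1` box (tail_row a) (tail_row b))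
     \int[lebesgue_measure]_(x in `]a ord0 ord0, b ord0 ord0[)
        (f (cons_row x (tuple_row t)))%:E)%E.
Proof.
move=> ab cf; set A := `]a ord0 ord0, _[%classic.
set B := _ @^-1` box (tail_row a) _; set D := _ @^-1` box a b.
pose k := EFin \o (f \o @tuple_row R d.+1).
have mf : measurable_fun setT k.
  by apply/measurable_EFinP; exact: measurable_tuple_row cf.
(* The type of the domain is that on which [lebesgue_measure] is defined: the
   reals with the sigma-algebra generated by the half-open intervals. *)
have mcons : @measurable_fun _ _ (measurableTypeR R * d.-tuple R)%type _ setT
    (@tuple_cons R d) := @measurable_tuple_cons R d.
have mB : measurable B := measurable_box _ _.
have mAB : measurable (A `*` B) by apply: measurableX => //; exact: measurable_itv.
have intk : (lebesgue_measure \x lebesgue_tuple R d)%E.-integrable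
    (@tuple_cons R d @^-1` D) (k \o @tuple_cons R d).
  apply: measurable_bounded_integrable.
  - by rewrite box_cons.
  - by have /andP[_] := lebesgue_box_gt0_lty ab.
  - apply: measurable_funTS.
    exact: measurableT_comp (measurable_tuple_row cf) mcons.
  - have [M hM] := bounded_box a b cf.
    exists M; split=> [|y My t abt /=]; first exact: num_real.
    by rewrite (le_trans (hM _ abt))// ltW.
have -> : (\int[lebesgue_tuple R d.+1]_(t in D) (f (tuple_row t))%:E =
    \int[lebesgue_measure \x lebesgue_tuple R d]_z
       ((k \o @tuple_cons R d) \_ (A `*` B)) z)%E.
  rewrite -integral_mkcond -box_cons.
  exact: (integral_pushforward mcons mf intk (measurable_box a b)).
have int_full : (lebesgue_measure \x lebesgue_tuple R d)%E.-integrable setT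
    ((k \o @tuple_cons R d) \_ (A `*` B)).
  by rewrite -integrable_mkcond// -box_cons.
have E x t : ((k \o @tuple_cons R d) \_ (A `*` B)) (x, t) =
    (if x \in A then
       if t \in B then (f (cons_row x (tuple_row t)))%:E else 0 else 0)%E.
  rewrite /patch in_setX /=; case: (x \in A) (t \in B) => [] [] //=.
  by rewrite /k /= tuple_row_cons.
split.
- rewrite -(integral12_prod_meas1 int_full); rewrite [RHS]integral_mkcond.
  apply: eq_integral => x _; rewrite /fubini_F; under eq_integral do rewrite E.
  rewrite /patch; case: ifPn => xA; last by rewrite integral0.
  by rewrite [RHS]integral_mkcond.
- rewrite -(integral21_prod_meas1 int_full); rewrite [RHS]integral_mkcond.
  apply: eq_integral => t _; rewrite /fubini_G; under eq_integral do rewrite E.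
  rewrite /patch; case: ifPn => tB; last first.
    by under eq_integral do rewrite if_same; rewrite integral0.
  by rewrite [RHS]integral_mkcond.
Qed.

(** In dimension one this is the fundamental theorem of calculus; a derivative
    in another direction is treated slice by slice, by induction on the
    dimension. *)
Lemma integral_partial_box d (a b : 'rV[R]_d) i (F DF : 'rV[R]_d -> R) :
  (forall i, a ord0 i < b ord0 i) -> continuous F -> continuous DF ->
  (forall x, is_derive x (unit_row R i) F (DF x)) ->
  (forall x, F (x + (b ord0 i - a ord0 i) *: unit_row R i) = F x) ->
  (\int[lebesgue_tuple R d]_(t in @tuple_row R d @^-1` box a b)
     (DF (tuple_row t))%:E = 0)%E.
Proof.
elim: d a b i F DF => [|d IH] a b i F DF ab cF cDF dF perF.
  by case: i dF perF.
case: (unliftP ord0 i) dF perF => [j ->|->] dF perF.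
  rewrite (integral_box_cons ab cDF).1; apply: integral0_eq => x _.
  apply: (IH _ _ j (F \o cons_row x) (DF \o cons_row x)).
  - by move=> k; rewrite !mxE.
  - by move=> v; apply: continuous_comp; [exact: continuous_cons_rowr|exact: cF].
  - by move=> v; apply: continuous_comp; [exact: continuous_cons_rowr|exact: cDF].
  - move=> v; apply: is_derive_line (dF (cons_row x v)) => h /=.
    by rewrite cons_row_addr.
  - by move=> v /=; rewrite !mxE addrC cons_row_addr addrC perF.
rewrite (integral_box_cons ab cDF).2; apply: integral0_eq => t _.
set v := tuple_row t.
have cFv : continuous (fun x => F (cons_row x v)).
  by move=> x; apply: continuous_comp; [exact: continuous_cons_rowl|exact: cF].
have cDFv : continuous (fun x => DF (cons_row x v)).
  by move=> x; apply: continuous_comp; [exact: continuous_cons_rowl|exact: cDF].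
have dFv (x : R) : is_derive x 1 (fun y : R => F (cons_row y v)) (DF (cons_row x v)).
  apply: is_derive_line (dF (cons_row x v)) => h /=.
  by rewrite /GRing.scale/= mulr1 cons_row_addl.
rewrite -(integral_itv_bndoo true false); last first.
  apply/measurable_EFinP; apply: measurable_funTS.
  exact: continuous_measurable_fun cDFv.
rewrite (@continuous_FTC2 _ _ (fun x => F (cons_row x v)))//.
- suff -> : F (cons_row (b ord0 ord0) v) = F (cons_row (a ord0 ord0) v).
    by rewrite subee.
  rewrite -[in LHS](subrK (a ord0 ord0) (b ord0 ord0)) cons_row_addl addrC.
  exact: perF.
- exact: continuous_subspaceT.
- split; first by move=> x _; case: (dFv x).
  + exact/cvg_at_right_filter/cFv.
  + exact/cvg_at_left_filter/cFv.
- by move=> x _; rewrite derive1E; case: (dFv x).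
Qed.

End periodic_divergence.

(** * Integration by parts on the periodic box *)

Section box_integral.
Context (R : realType) (d : nat) (a b : 'rV[R]_d).
Hypothesis ab : forall i, a ord0 i < b ord0 i.
Implicit Types f g : 'rV[R]_d -> R.

Local Notation intb f := (integral_rV (box a b) f).

Lemma eq_integral_box f g : (forall x, box a b x -> f x = g x) -> intb f = intb g.
Proof. by move=> fg; apply: eq_Rintegral => t; rewrite inE => abt; exact: fg. Qed.

Lemma integral_boxD f g : continuous f -> continuous g ->
  intb (fun x => f x + g x) = intb f + intb g.
Proof.
move=> cf cg; apply: (RintegralD _ (integrable_box ab cf) (integrable_box ab cg)).
exact: measurable_box.
Qed.

Lemma integral_boxZ c f : continuous f -> intb (fun x => c * f x) = c * intb f.
Proof.
by move=> cf; apply: (RintegralZl c _ (integrable_box ab cf)); exact: measurable_box.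
Qed.

Lemma integral_box_cst c : intb (fun=> c) = c * volume (box a b).
Proof. by rewrite /integral_rV Rintegral_cst//; exact: measurable_box. Qed.

Lemma continuous_sum (I : eqType) (s : seq I) (F : I -> 'rV[R]_d -> R) :
  (forall i, i \in s -> continuous (F i)) ->
  continuous (fun x => \sum_(i <- s) F i x).
Proof.
elim: s => [|i s IH] cF.
  rewrite (_ : (fun x => _) = cst 0); first exact: cst_continuous.
  by apply/funext => x; rewrite big_nil.
rewrite (_ : (fun x => _) = (fun x => F i x + \sum_(j <- s) F j x)).
  have cs : continuous (fun x => \sum_(j <- s) F j x).
    by apply: IH => j js; apply: cF; rewrite inE js orbT.
  by move=> x; exact: (cvgD (cF i (mem_head _ _) x) (cs x)).
by apply/funext => x; rewrite big_cons.
Qed.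

Lemma integral_box_sum (I : eqType) (s : seq I) (F : I -> 'rV[R]_d -> R) :
  (forall i, i \in s -> continuous (F i)) ->
  intb (fun x => \sum_(i <- s) F i x) = \sum_(i <- s) intb (F i).
Proof.
elim: s => [|i s IH] cF.
  rewrite big_nil -[RHS](mul0r (volume (box a b))) -integral_box_cst.
  by apply: eq_integral_box => x _; rewrite big_nil.
have cFs j : j \in s -> continuous (F j).
  by move=> js; apply: cF; rewrite inE js orbT.
rewrite big_cons -IH// -integral_boxD//.
- by apply: eq_integral_box => x _; rewrite big_cons.
- exact: cF (mem_head _ _).
- exact: continuous_sum.
Qed.

Lemma integral_box_ge0 f : (forall x, 0 <= f x) -> 0 <= intb f.
Proof. by move=> f0; apply: Rintegral_ge0 => t _; exact: f0. Qed.

Lemma volume_box_gt0 : 0 < volume (box a b).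
Proof. by apply: fine_gt0; exact: lebesgue_box_gt0_lty. Qed.

Lemma integral_box_partial i (F DF : 'rV[R]_d -> R) :
  continuous F -> continuous DF ->
  (forall x, is_derive x (unit_row R i) F (DF x)) ->
  (forall x, F (x + (b ord0 i - a ord0 i) *: unit_row R i) = F x) ->
  intb DF = 0.
Proof.
by move=> cF cDF dF perF; rewrite /integral_rV /Rintegral integral_partial_box.
Qed.

Lemma partial_periodic i f : box_periodic a b f -> box_periodic a b (partial i f).
Proof.
move=> perf j x; rewrite /partial /derive.
rewrite (_ : (fun h => h^-1 *: ((f \o shift (x + (b ord0 j - a ord0 j) *: unit_row R j))
    (h *: unit_row R i) - f (x + (b ord0 j - a ord0 j) *: unit_row R j))) =
  (fun h => h^-1 *: ((f \o shift x) (h *: unit_row R i) - f x)))//.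
by apply/funext => h /=; rewrite perf addrA perf.
Qed.

End box_integral.

Section C2_functions.
Context (R : realType) (d : nat).
Implicit Types f : 'rV[R]_d -> R.

Lemma class_C2_continuous f : class_C 2 f -> continuous f.
Proof. by case. Qed.

Lemma class_C2_partial f i : class_C 2 f -> continuous (partial i f).
Proof. by case=> _ /(_ i)[_ []]. Qed.

Lemma class_C2_partial2 f i : class_C 2 f -> continuous (partial i (partial i f)).
Proof. by case=> _ /(_ i)[_ [_ /(_ i)[_]]]. Qed.

Lemma class_C2_is_derive f i x : class_C 2 f ->
  is_derive x (unit_row R i) f (partial i f x).
Proof. by case=> _ /(_ i)[df _]; split=> //; exact: df. Qed.

Lemma class_C2_is_derive2 f i x : class_C 2 f ->
  is_derive x (unit_row R i) (partial i f) (partial i (partial i f) x).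
Proof. by case=> _ /(_ i)[_ [_ /(_ i)[df _]]]; split=> //; exact: df. Qed.

End C2_functions.

Section green.
Context (R : realType) (d : nat) (a b : 'rV[R]_d).
Hypothesis ab : forall i, a ord0 i < b ord0 i.

Lemma is_derive_mean (f g : 'rV[R]_d -> R) (x v : 'rV[R]_d) (df dg : R) :
  is_derive x v f df -> is_derive x v g dg ->
  is_derive x v (fun y => (f y + g y) / 2) ((df + dg) / 2).
Proof.
move=> hf hg; have h := is_deriveZ 2^-1 (is_deriveD hf hg).
rewrite (_ : (fun y => (f y + g y) / 2) = 2^-1 \*: (f + g)); last first.
  by apply/funext => y; rewrite /= mulrC.
by apply: (is_derive_eq h); rewrite mulrC.
Qed.

Lemma partial_mean (f g : 'rV[R]_d -> R) i :
  (forall x, derivable f x (unit_row R i)) ->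
  (forall x, derivable g x (unit_row R i)) ->
  partial i (fun y => (f y + g y) / 2) =
  (fun y => (partial i f y + partial i g y) / 2).
Proof.
move=> df dg; apply/funext => x; rewrite /partial.
by case: (is_derive_mean (derivableP (df x)) (derivableP (dg x))).
Qed.

Lemma laplacian_mean (f g : 'rV[R]_d -> R) x : class_C 2 f -> class_C 2 g ->
  laplacian (fun y => (f y + g y) / 2) x =
  \sum_(i < d) (partial i (partial i f) x + partial i (partial i g) x) / 2.
Proof.
move=> Cf Cg; apply: eq_bigr => i _; rewrite !partial_mean//.
- by move=> y; case: (class_C2_is_derive2 i y Cf).
- by move=> y; case: (class_C2_is_derive2 i y Cg).
- by move=> y; case: (class_C2_is_derive i y Cf).
- by move=> y; case: (class_C2_is_derive i y Cg).
Qed.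

(** The derivative in direction [i] of [(f - g)] times the partial derivative of
    the mean of [f] and [g]; its sum over [i] is a divergence. *)
Definition green_density (f g : 'rV[R]_d -> R) i x : R :=
  (f x - g x) * ((partial i (partial i f) x + partial i (partial i g) x) / 2)
  + (partial i f x + partial i g x) / 2 * (partial i f x - partial i g x).

Lemma continuous_green_density f g i : class_C 2 f -> class_C 2 g ->
  continuous (green_density f g i).
Proof.
move=> Cf Cg x; rewrite /green_density.
have cf := @class_C2_continuous _ _ f Cf x; have cg := @class_C2_continuous _ _ g Cg x.
have c1f := @class_C2_partial _ _ f i Cf x; have c1g := @class_C2_partial _ _ g i Cg x.
have c2f := @class_C2_partial2 _ _ f i Cf x; have c2g := @class_C2_partial2 _ _ g i Cg x.
exact: (cvgD (cvgM (cvgB cf cg) (cvgM (cvgD c2f c2g) (cvg_cst _)))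
             (cvgM (cvgM (cvgD c1f c1g) (cvg_cst _)) (cvgB c1f c1g))).
Qed.

Lemma integral_green_density f g i : class_C 2 f -> class_C 2 g ->
  box_periodic a b f -> box_periodic a b g ->
  integral_rV (box a b) (green_density f g i) = 0.
Proof.
move=> Cf Cg perf perg.
apply: (@integral_box_partial R d a b ab i
  (fun x => (f x - g x) * ((partial i f x + partial i g x) / 2))).
- move=> x.
  have cf := @class_C2_continuous _ _ f Cf x; have cg := @class_C2_continuous _ _ g Cg x.
  have c1f := @class_C2_partial _ _ f i Cf x; have c1g := @class_C2_partial _ _ g i Cg x.
  exact: (cvgM (cvgB cf cg) (cvgM (cvgD c1f c1g) (cvg_cst _))).
- exact: continuous_green_density.
- move=> x.
  have d1 := is_deriveB (class_C2_is_derive i x Cf) (class_C2_is_derive i x Cg).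
  have d2 := is_derive_mean (class_C2_is_derive2 i x Cf) (class_C2_is_derive2 i x Cg).
  exact: (is_derive_eq (is_deriveM d1 d2)).
- by move=> x; rewrite perf perg !(partial_periodic _ _).
Qed.

End green.

(** * The energy law of the scheme *)

Section CN_IEQ_energy.
Context (R : realType) (d : nat).
Context (alpha lambda eps beta : R).
Hypotheses (alpha01 : 0 < alpha < 1) (lambda0 : 0 < lambda).
Context (a b : 'rV[R]_d).
Hypothesis ab : forall i, a ord0 i < b ord0 i.
Context (N : nat) (t : nat -> R).
Hypothesis t_incr : forall k, (k < N)%N -> t k < t k.+1.
Context (phi u : nat -> 'rV[R]_d -> R) (eta : nat -> R) (w1 : 'rV[R]_d -> R).
Hypothesis phi_per : forall n, (n <= N)%N -> box_periodic a b (phi n).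
Hypothesis phi_C2 : forall n, (n <= N)%N -> class_C 2 (phi n).
Hypothesis u_C0 : forall n, (n <= N)%N -> class_C 0 (u n).
Hypothesis scheme : forall n, (1 <= n <= N)%N ->
  CN_IEQ_step alpha lambda eps beta a b t w1 phi u eta n.

Local Notation intb f := (integral_rV (box a b) f).

Lemma continuous_bdiff n : (n <= N)%N -> continuous (bdiff phi n).
Proof.
move=> nN x; have n1N : (n.-1 <= N)%N := leq_trans (leq_pred n) nN.
exact: (cvgB (@class_C2_continuous _ _ _ (phi_C2 nN) x)
             (@class_C2_continuous _ _ _ (phi_C2 n1N) x)).
Qed.

Lemma continuous_L1plus_term n k : (k <= N)%N ->
  continuous (fun x => L1plus_coef alpha t n k * bdiff phi k x).
Proof.
by move=> kN x; exact: (cvgM (cvg_cst _) (@continuous_bdiff k kN x)).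
Qed.

Lemma continuous_L1plus n : (n <= N)%N -> continuous (L1plus alpha t phi n).
Proof.
move=> nN; apply: continuous_sum => k; rewrite mem_index_iota => /andP[_ kn].
by apply: continuous_L1plus_term; rewrite (leq_trans _ nN).
Qed.

Lemma integral_L1plus n : (n <= N)%N ->
  intb (L1plus alpha t phi n) =
  \sum_(1 <= k < n.+1) L1plus_coef alpha t n k * intb (bdiff phi k).
Proof.
move=> nN; rewrite integral_box_sum// => [|k]; last first.
  rewrite mem_index_iota => /andP[_ kn].
  by apply: continuous_L1plus_term; rewrite (leq_trans _ nN).
apply: eq_big_nat => k /andP[_ kn].
by rewrite integral_boxZ//; apply: continuous_bdiff; rewrite (leq_trans _ nN).
Qed.

(** The first equation solved for the potential.  Unlike its defining
    expression, the right-hand side is visibly continuous. *)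
Lemma potentialE n x : (1 <= n <= N)%N -> box a b x ->
  potential eps beta t w1 phi u n x =
  eta n + - lambda^-1 * L1plus alpha t phi n x.
Proof.
move=> nN abx; have [/(_ x abx) -> _ _] := scheme nN.
by rewrite mulrA mulrNN mulVf ?gt_eqF// mul1r; ring.
Qed.

(** [eta] is the mean of the potential, so the right-hand side of the first
    equation has mean zero. *)
Lemma integral_L1plus_eq0 n : (1 <= n <= N)%N -> intb (L1plus alpha t phi n) = 0.
Proof.
move=> nN; have [_ etaE _] := scheme nN; have /andP[_ nN'] := nN.
have V0 := volume_box_gt0 ab.
have potI : intb (potential eps beta t w1 phi u n) =
    eta n * volume (box a b) + - lambda^-1 * intb (L1plus alpha t phi n).
  rewrite (eq_integral_box (fun x abx => potentialE nN abx)).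
  have cL := @continuous_L1plus n nN'.
  rewrite integral_boxD//; last 2 first.
  - exact: cst_continuous.
  - by move=> x; exact: (cvgM (cvg_cst _) (cL x)).
  by rewrite integral_box_cst// integral_boxZ.
have : lambda^-1 * intb (L1plus alpha t phi n) = 0.
  apply/eqP; rewrite -oppr_eq0 -mulNr; apply/eqP.
  apply: (addrI (eta n * volume (box a b))).
  by rewrite -potI etaE addr0 mulrC mulrA mulfV ?gt_eqF// mul1r.
by move/eqP; rewrite mulf_eq0 invr_eq0 gt_eqF//= => /eqP.
Qed.

(** Forward substitution in the triangular system given by
    [integral_L1plus_eq0]. *)
Lemma mass_conservation n : (1 <= n <= N)%N -> intb (bdiff phi n) = 0.
Proof.
elim/ltn_ind: n => n IH nN; have /andP[n1 nN'] := nN.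
have := integral_L1plus_eq0 nN; rewrite integral_L1plus//.
rewrite big_nat_recr//= big_nat_cond big1 ?add0r => [|k]; last first.
  rewrite andbT => /andP[k1 kn]; rewrite IH ?mulr0// k1/=.
  exact: leq_trans (ltnW kn) nN'.
move/eqP; rewrite mulf_eq0 gt_eqF ?(L1plus_coef_diag_gt0 alpha01 t_incr)//=.
by move/eqP.
Qed.

Definition energy_density n (x : 'rV[R]_d) : R :=
  eps ^+ 2 / 2 * sqnorm2 (gradient (phi n) x) + beta / 2 * `|phi n x| ^+ 2
    + 4^-1 * u n x ^+ 2.

Lemma continuous_energy_density n : (n <= N)%N -> continuous (energy_density n).
Proof.
move=> nN; have Cn := phi_C2 nN.
have cg : continuous (fun x => sqnorm2 (gradient (phi n) x)).
  apply: continuous_sum => i _.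
  rewrite (_ : (fun x => _) = (fun x => partial i (phi n) x * partial i (phi n) x)).
    by move=> x; have c1 := @class_C2_partial _ _ _ i Cn x; exact: (cvgM c1 c1).
  by apply/funext => x; rewrite mxE expr2.
rewrite (_ : energy_density n = (fun x => eps ^+ 2 / 2 * sqnorm2 (gradient (phi n) x)
    + beta / 2 * (phi n x * phi n x) + 4^-1 * (u n x * u n x))); last first.
  by apply/funext => x; rewrite /energy_density real_normK ?num_real// !expr2.
move=> x; have c0 := @class_C2_continuous _ _ _ Cn x.
have cun : continuous (u n) := u_C0 nN; have cu := cun x.
exact: (cvgD (cvgD (cvgM (cvg_cst _) (cg x)) (cvgM (cvg_cst _) (cvgM c0 c0)))
  (cvgM (cvg_cst _) (cvgM cu cu))).
Qed.

(** A mean times an increment is the increment of half a square, so the energy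
    increment is the potential times the increment of [phi] plus a divergence;
    [potentialE] then replaces the potential. *)
Lemma energy_density_step n x : (1 <= n <= N)%N -> box a b x ->
  energy_density n x + -1 * energy_density n.-1 x =
  eta n * bdiff phi n x
  + - lambda^-1 * (L1plus alpha t phi n x * bdiff phi n x)
  + eps ^+ 2 * \sum_(i < d) green_density (phi n) (phi n.-1) i x.
Proof.
move=> nN abx; have /andP[n1 nN'] := nN.
have n1N : (n.-1 <= N)%N := leq_trans (leq_pred n) nN'.
have [_ _ /(_ x abx)] := scheme nN.
have tau0 := mesh_step_gt0 t_incr nN.
rewrite /dquot mulrA => /(mulIf (invr_neq0 (lt0r_neq0 tau0))) du.
have := potentialE nN abx.
rewrite /potential laplacian_mean//; [|exact: phi_C2|exact: phi_C2].
set hat := extrapolation _ _ _ _ _; set L := L1plus _ _ _ _ _.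
rewrite -/hat in du.
move=> potE.
have -> : eta n * bdiff phi n x + - lambda^-1 * (L * bdiff phi n x) =
    (eta n + - lambda^-1 * L) * bdiff phi n x by ring.
rewrite -potE.
have hatE : mid u n x * hat * bdiff phi n x = mid u n x * bdiff u n x / 2.
  by rewrite du; move: (mid _ _ _) (bdiff _ _ _) => m D; field.
have -> : \sum_(i < d) green_density (phi n) (phi n.-1) i x =
   bdiff phi n x * (\sum_(i < d) (partial i (partial i (phi n)) x +
      partial i (partial i (phi n.-1)) x) / 2) +
   2^-1 * (sqnorm2 (gradient (phi n) x) - sqnorm2 (gradient (phi n.-1) x)).
  rewrite /sqnorm2 -sumrB !mulr_sumr -big_split; apply: eq_bigr => i _ /=.
  have alg (c h p q : R) :
    c * h + (p + q) / 2 * (p - q) = c * h + 2^-1 * (p ^+ 2 - q ^+ 2) by field.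
  by rewrite !mxE; exact: alg.
have alg (p0 p1 u0 u1 S0 S1 lap h : R) :
    (u1 + u0) / 2 * h * (p1 - p0) = (u1 + u0) / 2 * (u1 - u0) / 2 ->
    eps ^+ 2 / 2 * S1 + beta / 2 * p1 ^+ 2 + 4^-1 * u1 ^+ 2 +
    -1 * (eps ^+ 2 / 2 * S0 + beta / 2 * p0 ^+ 2 + 4^-1 * u0 ^+ 2) =
    (- eps ^+ 2 * lap + beta * ((p1 + p0) / 2) + (u1 + u0) / 2 * h) * (p1 - p0)
    + eps ^+ 2 * ((p1 - p0) * lap + 2^-1 * (S1 - S0)).
  by move=> hE; rewrite [X in _ = X + _]mulrDl hE; field.
rewrite /energy_density !real_normK ?num_real//; exact: alg.
Qed.

Lemma energy_step n : (1 <= n <= N)%N ->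
  energy eps beta a b (phi n) (u n) - energy eps beta a b (phi n.-1) (u n.-1) =
  - lambda^-1 * intb (fun x => L1plus alpha t phi n x * bdiff phi n x).
Proof.
move=> nN; have /andP[n1 nN'] := nN.
have n1N : (n.-1 <= N)%N := leq_trans (leq_pred n) nN'.
have cL := @continuous_L1plus n nN'; have cd := @continuous_bdiff n nN'.
have cLd : continuous (fun x => L1plus alpha t phi n x * bdiff phi n x).
  by move=> x; exact: (cvgM (cL x) (cd x)).
have cG : continuous (fun x => \sum_(i < d) green_density (phi n) (phi n.-1) i x).
  by apply: continuous_sum => i _; apply: continuous_green_density; exact: phi_C2.
have cc (c : R) f : continuous f -> continuous (fun x : 'rV[R]_d => c * f x).
  by move=> cf x; exact: (cvgM (cvg_cst _) (cf x)).
have cD f g : continuous f -> continuous g -> 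
    continuous (fun x : 'rV[R]_d => f x + g x : R).
  by move=> cf cg x; exact: (cvgD (cf x) (cg x)).
rewrite /energy -/(energy_density n) -/(energy_density n.-1).
transitivity (intb (fun x => energy_density n x + -1 * energy_density n.-1 x)).
  have ce := @continuous_energy_density n nN'.
  have ce1 := @continuous_energy_density n.-1 n1N.
  by rewrite integral_boxD//; [rewrite integral_boxZ//; ring|exact: cc].
rewrite (eq_integral_box (fun x abx => energy_density_step nN abx)).
rewrite integral_boxD//; [|by apply: cD; exact: cc|exact: cc].
rewrite integral_boxD//; [|exact: cc|exact: cc].
rewrite !integral_boxZ// mass_conservation// mulr0 add0r.
rewrite integral_box_sum//; last first.
  by move=> i _; apply: continuous_green_density; exact: phi_C2.
rewrite big1 ?mulr0 ?addr0// => i _.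
apply: integral_green_density => //.
- exact: phi_C2.
- exact: phi_C2.
- exact: phi_per.
- exact: phi_per.
Qed.

(** Telescoping [energy_step] gives the L1+ quadratic form at every point. *)
Lemma energy_le m : (m <= N)%N ->
  energy eps beta a b (phi m) (u m) - energy eps beta a b (phi 0%N) (u 0%N) <= 0.
Proof.
move=> mN.
have -> : energy eps beta a b (phi m) (u m) - energy eps beta a b (phi 0%N) (u 0%N) =
    - lambda^-1 * \sum_(1 <= n < m.+1)
       intb (fun x => L1plus alpha t phi n x * bdiff phi n x).
  elim: m mN => [|m IH] mN; first by rewrite big_geq// mulr0 subrr.
  rewrite big_nat_recr//= mulrDr -IH ?(ltnW mN)// -energy_step//=; ring.
rewrite mulNr oppr_le0 mulr_ge0 ?invr_ge0 ?(ltW lambda0)//.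
rewrite -integral_box_sum//; last first.
  move=> n; rewrite mem_index_iota => /andP[_ nm].
  have nN : (n <= N)%N by rewrite (leq_trans _ mN).
  by move=> x; exact: (cvgM (@continuous_L1plus n nN x) (@continuous_bdiff n nN x)).
apply: integral_box_ge0 => x.
by apply: L1plus_psd => // k km; apply: t_incr; rewrite (leq_trans km).
Qed.

End CN_IEQ_energy.

Theorem theorem3p2 (R : realType) (d : nat) (hd : (0 < d)%N)
    (alpha lambda eps beta : R)
    (halpha : 0 < alpha < 1) (hlambda : 0 < lambda) (heps : 0 < eps)
    (a b : 'rV[R]_d) (hab : forall i, a ord0 i < b ord0 i)
    (N : nat) (T : R) (t : nat -> R)
    (ht0 : t 0%N = 0) (htN : t N = T)
    (ht : forall k, (k < N)%N -> t k < t k.+1)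
    (phi u : nat -> 'rV[R]_d -> R) (eta : nat -> R)
    (phi0 phihat1 : 'rV[R]_d -> R)
    (hphi_per : forall n, (n <= N)%N -> box_periodic a b (phi n))
    (hphi_C2 : forall n, (n <= N)%N -> class_C 2 (phi n))
    (hu_per : forall n, (n <= N)%N -> box_periodic a b (u n))
    (hu_C0 : forall n, (n <= N)%N -> class_C 0 (u n))
    (hphihat1_per : box_periodic a b phihat1)
    (hphihat1_C0 : class_C 0 phihat1)
    (hphi0 : forall x, box a b x -> phi 0%N x = phi0 x)
    (hu0 : forall x, box a b x -> u 0%N x = phi0 x ^+ 2 - 1 - beta)
    (hscheme : forall n, (1 <= n <= N)%N ->
       CN_IEQ_step alpha lambda eps beta a b t phihat1 phi u eta n) :
  forall n, (1 <= n <= N)%N ->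
    energy eps beta a b (phi n) (u n) - energy eps beta a b (phi 0%N) (u 0%N)
    <= 0.
Proof.
move=> n /andP[_ nN].
exact: (energy_le halpha hlambda hab ht hphi_per hphi_C2 hu_C0 hscheme nN).
Qed.
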